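(* Assume that $H$ is a Gorenstein ring. Endow $\mathrm{Mod}(H)$ with the Gorenstein projective model structure and $\mathrm{Rep}^\infty_k(G)$ with the $I$-Gorenstein projective model structure. In the derived adjunction $$LF:\mathrm{Ho}(\mathrm{Mod}(H))\rightleftarrows\mathrm{Ho}(\mathrm{Rep}_k^\infty(G)):RU$$ the functor $LF$ is faithful and the functor $RU$ is essentially surjective.
   Context: Let $k$ be a field of characteristic $p>0$ and $G$ a topological group (possibly discrete) admitting an open pro-$p$ subgroup $I$. $\mathrm{Rep}_k^\infty(G)$ is the category of smooth $k$-linear $G$-representations (stabilizers of vectors are open). $\mathbb{X}=\mathrm{ind}_I^G(k)$ is the space of compactly supported $f:G\to k$ with $f(gi)=f(g)$ for $i\in I$, with action $(gf)(g')=f(g^{-1}g')$; $H=\mathrm{End}_G(\mathbb{X})^{\mathrm{op}}$; $\mathrm{Mod}(H)$ is the category of left $H$-modules. There is an adjunction $F:\mathrm{Mod}(H)\rightleftarrows\mathrm{Rep}^\infty_k(G):U$ ($F$ left adjoint), $FM=\mathbb{X}\otimes_HM$, $UV=V^I\cong\mathrm{Hom}_G(\mathbb{X},V)$. A ring is Gorenstein if it is left and right noetherian with finite injective dimension as a left and right module over itself. An $H$-module $M$ is Gorenstein projective if $M=\ker(d_0)=\mathrm{im}(d_1)$ for an acyclic complex $(Y_\bullet,d_\bullet)$ of projectives which stays exact under $\mathrm{Hom}_H(\cdot,P)$ for all projective $P$. The Gorenstein projective model structure on $\mathrm{Mod}(H)$ has as cofibrations the monomorphisms with Gorenstein projective cokernel,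 as fibrations the epimorphisms, and as trivial objects the modules of finite projective dimension (its trivial cofibrations are the monomorphisms with projective cokernel, its trivial fibrations the epimorphisms with kernel of finite projective dimension, its weak equivalences the composites of a trivial cofibration followed by a trivial fibration). The $I$-Gorenstein projective model structure on $\mathrm{Rep}^\infty_k(G)$ is its right transfer: $f$ is a fibration (resp. weak equivalence) iff $Uf$ is one in $\mathrm{Mod}(H)$, and cofibrations are the maps with the left lifting property with respect to all trivial fibrations. $(F,U)$ is then a Quillen adjunction; $LF$ and $RU$ denote the left and right derived functors. *)

(* Defs.v *)
From HB Require Import structures.
From mathcomp Require Import all_boot all_order all_algebra finmap.
From mathcomp Require Import boolp classical_sets functions cardinality fsbigop.
From mathcomp Require Import topology.

Set Implicit Arguments.
Unset Strict Implicit.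
Unset Printing Implicit Defensive.

Import GRing.Theory.
Local Open Scope classical_set_scope.
Local Open Scope ring_scope.

(* Equality of morphisms is the equivalence relation [eqh]; no quotient of  *)
(* hom types is ever taken.                                                 *)

Record category := Category {
  obj :> Type;
  hom : obj -> obj -> Type;
  eqh : forall a b, hom a b -> hom a b -> Prop;
  idh : forall a, hom a a;
  comph : forall a b c, hom b c -> hom a b -> hom a c;
  eqh_refl : forall a b (f : hom a b), eqh f f;
  eqh_sym : forall a b (f g : hom a b), eqh f g -> eqh g f;
  eqh_trans : forall a b (f g h : hom a b), eqh f g -> eqh g h -> eqh f h;
  comph_eqh : forall a b c (g g' : hom b c) (f f' : hom a b),
    eqh g g' -> eqh f f' -> eqh (comph g f) (comph g' f');
  comphA : forall a b c d (h : hom c d) (g : hom b c) (f : hom a b),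
    eqh (comph h (comph g f)) (comph (comph h g) f);
  comp1h : forall a b (f : hom a b), eqh (comph (idh b) f) f;
  comph1 : forall a b (f : hom a b), eqh (comph f (idh a)) f }.

Arguments hom {_} a b.
Arguments idh {_} a.

Notation "g '\oc' f" := (comph g f) (at level 50, left associativity).
Notation "f '=h' g" := (eqh f g) (at level 70, no associativity).

Record functor (C D : category) := Functor {
  fobj :> C -> D;
  fhom : forall a b : C, hom a b -> hom (fobj a) (fobj b);
  fhom_eqh : forall (a b : C) (f g : hom a b), f =h g -> fhom f =h fhom g;
  fhom_id : forall a : C, fhom (idh a) =h idh (fobj a);
  fhom_comp : forall (a b c : C) (g : hom b c) (f : hom a b),
    fhom (g \oc f) =h fhom g \oc fhom f }.

Arguments fhom {C D} f {a b} _ : rename.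

Section CategoryTheory.
Variable C : category.

Definition is_iso (a b : C) (f : hom a b) : Prop :=
  exists g : hom b a, g \oc f =h idh a /\ f \oc g =h idh b.

Definition isomorphic (a b : C) : Prop := exists f : hom a b, is_iso f.

Definition initial (a : C) : Prop :=
  forall b, exists f : hom a b, forall g : hom a b, g =h f.

Definition terminal (a : C) : Prop :=
  forall b, exists f : hom b a, forall g : hom b a, g =h f.

End CategoryTheory.

Section FunctorTheory.
Variables C D : category.

Definition natural (F G : functor C D) (t : forall a, hom (F a) (G a)) : Prop :=
  forall (a b : C) (f : hom a b), t b \oc fhom F f =h fhom G f \oc t a.

Definition naturally_isomorphic (F G : functor C D) : Prop :=
  exists t : forall a, hom (F a) (G a), natural t /\ forall a, is_iso (t a).

Definition faithful (F : functor C D) : Prop :=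
  forall (a b : C) (f g : hom a b), fhom F f =h fhom F g -> f =h g.

Definition essentially_surjective (F : functor C D) : Prop :=
  forall d : D, exists c : C, isomorphic (F c) d.

End FunctorTheory.

Section IdentityFunctor.
Variable C : category.

Lemma idf_subproof :
  (forall (a b : C) (f g : hom a b), f =h g -> f =h g) /\
  (forall a : C, idh a =h idh a) /\
  (forall (a b c : C) (g : hom b c) (f : hom a b), g \oc f =h g \oc f).
Proof. by split=> //; split=> *; exact: eqh_refl. Qed.

Definition idf : functor C C :=
  @Functor C C (fun a => a) (fun a b f => f) idf_subproof.1
    idf_subproof.2.1 idf_subproof.2.2.

End IdentityFunctor.

Arguments idf {C}.

Section CompositeFunctor.
Variables (C D E : category) (G : functor D E) (F : functor C D).

Lemma compf_subproof :
  (forall (a b : C) (f g : hom a b), f =h g -> fhom G (fhom F f) =h fhom G (fhom F g)) /\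
  (forall a : C, fhom G (fhom F (idh a)) =h idh (G (F a))) /\
  (forall (a b c : C) (g : hom b c) (f : hom a b),
     fhom G (fhom F (g \oc f)) =h fhom G (fhom F g) \oc fhom G (fhom F f)).
Proof.
split; last split.
- by move=> a b f g fg; do 2 apply: fhom_eqh.
- move=> a; apply: eqh_trans (fhom_id _ _); apply: fhom_eqh; exact: fhom_id.
- move=> a b c g f; apply: eqh_trans (fhom_comp _ _ _).
  apply: fhom_eqh; exact: fhom_comp.
Qed.

Definition compf : functor C E :=
  @Functor C E (fun a => G (F a)) (fun a b f => fhom G (fhom F f))
    compf_subproof.1 compf_subproof.2.1 compf_subproof.2.2.

End CompositeFunctor.

(* The localization at W: formal composites of morphisms of C and of formal *)
(* inverses of morphisms in W, modulo the evident relations. No smallness   *)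
(* is needed, morphisms only live in a larger universe.                     *)

Section Localization.
Variables (C : category) (W : forall a b : C, hom a b -> Prop).

Inductive loc_hom : C -> C -> Type :=
  | loc_fwd a b : hom a b -> loc_hom a b
  | loc_inv a b (w : hom a b) : W w -> loc_hom b a
  | loc_comp a b c : loc_hom b c -> loc_hom a b -> loc_hom a c.

Inductive loc_eq : forall a b, loc_hom a b -> loc_hom a b -> Prop :=
  | loc_eq_refl a b (f : loc_hom a b) : loc_eq f f
  | loc_eq_sym a b (f g : loc_hom a b) : loc_eq f g -> loc_eq g f
  | loc_eq_trans a b (f g h : loc_hom a b) :
      loc_eq f g -> loc_eq g h -> loc_eq f h
  | loc_eq_comp a b c (g g' : loc_hom b c) (f f' : loc_hom a b) :
      loc_eq g g' -> loc_eq f f' -> loc_eq (loc_comp g f) (loc_comp g' f')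
  | loc_eq_compA a b c d (h : loc_hom c d) (g : loc_hom b c) (f : loc_hom a b) :
      loc_eq (loc_comp h (loc_comp g f)) (loc_comp (loc_comp h g) f)
  | loc_eq_comp1f a b (f : loc_hom a b) :
      loc_eq (loc_comp (loc_fwd (idh b)) f) f
  | loc_eq_compf1 a b (f : loc_hom a b) :
      loc_eq (loc_comp f (loc_fwd (idh a))) f
  | loc_eq_fwd a b (f g : hom a b) : f =h g -> loc_eq (loc_fwd f) (loc_fwd g)
  | loc_eq_fwd_comp a b c (g : hom b c) (f : hom a b) :
      loc_eq (loc_fwd (g \oc f)) (loc_comp (loc_fwd g) (loc_fwd f))
  | loc_eq_invl a b (w : hom a b) (Ww : W w) :
      loc_eq (loc_comp (loc_inv Ww) (loc_fwd w)) (loc_fwd (idh a))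
  | loc_eq_invr a b (w : hom a b) (Ww : W w) :
      loc_eq (loc_comp (loc_fwd w) (loc_inv Ww)) (loc_fwd (idh b)).

Definition localization : category :=
  @Category C loc_hom loc_eq (fun a => loc_fwd (idh a)) loc_comp
    loc_eq_refl loc_eq_sym loc_eq_trans loc_eq_comp loc_eq_compA
    loc_eq_comp1f loc_eq_compf1.

Definition loc_functor : functor C localization :=
  @Functor C localization (fun a => a) loc_fwd loc_eq_fwd
    (fun a => loc_eq_refl (loc_fwd (idh a))) loc_eq_fwd_comp.

End Localization.

(* Only the three classes of morphisms of a model structure are recorded;   *)
(* Ho and the derived functors depend on nothing else.                      *)

Record model_classes (C : category) := ModelClasses {
  cofibration : forall a b : C, hom a b -> Prop;
  fibration : forall a b : C, hom a b -> Prop;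
  weak_equivalence : forall a b : C, hom a b -> Prop }.

Arguments cofibration {C} m {a b} _.
Arguments fibration {C} m {a b} _.
Arguments weak_equivalence {C} m {a b} _.

Section ModelCategory.
Variables (C : category) (M : model_classes C).

Definition trivial_cofibration (a b : C) (f : hom a b) : Prop :=
  cofibration M f /\ weak_equivalence M f.

Definition trivial_fibration (a b : C) (f : hom a b) : Prop :=
  fibration M f /\ weak_equivalence M f.

Definition cofibrant (a : C) : Prop :=
  forall (z : C) (f : hom z a), initial z -> cofibration M f.

Definition fibrant (a : C) : Prop :=
  forall (z : C) (f : hom a z), terminal z -> fibration M f.

Definition Ho : category := localization (@weak_equivalence C M).

Definition gamma : functor C Ho := loc_functor (@weak_equivalence C M).

Definition cofibrant_replacement
    (Q : functor C C) (q : forall a, hom (Q a) (@idf C a)) : Prop :=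
  natural q /\ forall a, cofibrant (Q a) /\ trivial_fibration (q a).

Definition fibrant_replacement
    (R : functor C C) (r : forall a, hom (@idf C a) (R a)) : Prop :=
  natural r /\ forall a, fibrant (R a) /\ trivial_cofibration (r a).

End ModelCategory.

Section DerivedFunctors.
Variables (C D : category) (MC : model_classes C) (MD : model_classes D).

(* The total left derived functor of F is induced by F \o Q, for Q a        *)
(* functorial cofibrant replacement; as the localization functor is the     *)
(* identity on objects and is universal, L is determined up to natural      *)
(* isomorphism by its composite with it.                                    *)
Definition total_left_derived
    (F : functor C D) (L : functor (Ho MC) (Ho MD)) : Prop :=
  exists (Q : functor C C) (q : forall a, hom (Q a) (@idf C a)),
    cofibrant_replacement MC q /\
    naturally_isomorphic (compf L (gamma MC)) (compf (gamma MD) (compf F Q)).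

Definition total_right_derived
    (U : functor D C) (K : functor (Ho MD) (Ho MC)) : Prop :=
  exists (R : functor D D) (r : forall a, hom (@idf D a) (R a)),
    fibrant_replacement MD r /\
    naturally_isomorphic (compf K (gamma MD)) (compf (gamma MC) (compf U R)).

Definition left_lifting (a b x y : D) (f : hom a b) (g : hom x y) : Prop :=
  forall (u : hom a x) (v : hom b y), v \oc f =h g \oc u ->
  exists h : hom b x, h \oc f =h u /\ g \oc h =h v.

Definition right_transfer (U : functor D C) : model_classes D :=
  @ModelClasses D
    (fun a b f => forall (x y : D) (g : hom x y),
       fibration MC (fhom U g) -> weak_equivalence MC (fhom U g) ->
       left_lifting f g)
    (fun a b f => fibration MC (fhom U f))
    (fun a b f => weak_equivalence MC (fhom U f)).

End DerivedFunctors.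

Section Modules.
Variable R : pzRingType.

Definition Mod : category.
Proof.
refine (@Category (lmodType R) (fun M N => {linear M -> N})
  (fun M N f g => f =1 g) (fun M => idfun) (fun M N P g f => g \o f)
  _ _ _ _ _ _ _) => //.
- by move=> M N f g fg x; rewrite fg.
- by move=> M N f g h fg gh x; rewrite fg gh.
- by move=> M N P g g' f f' gg' ff' x /=; rewrite ff' gg'.
Defined.

Definition surjective (A B : Type) (f : A -> B) : Prop :=
  forall b, exists a, f a = b.

Definition exact (L M N : lmodType R) (f : L -> M) (g : M -> N) : Prop :=
  forall y, g y = 0 <-> exists x, f x = y.

Definition projective (P : lmodType R) : Prop :=
  forall (M N : lmodType R) (p : {linear M -> N}) (f : {linear P -> N}),
    surjective p -> exists h : {linear P -> M}, forall x, p (h x) = f x.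

Definition injective_module (E : lmodType R) : Prop :=
  forall (M N : lmodType R) (i : {linear M -> N}) (f : {linear M -> E}),
    injective i -> exists h : {linear N -> E}, forall x, h (i x) = f x.

Definition finite_projective_dimension (M : lmodType R) : Prop :=
  exists (n : nat) (P : nat -> lmodType R)
         (d : forall i, {linear P i.+1 -> P i}) (e : {linear P 0%N -> M}),
    [/\ forall i, projective (P i),
        forall i, (n < i)%N -> forall x : P i, x = 0,
        surjective e, exact (d 0%N) e & forall i, exact (d i.+1) (d i)].

Definition finite_injective_dimension (M : lmodType R) : Prop :=
  exists (n : nat) (E : nat -> lmodType R)
         (d : forall i, {linear E i -> E i.+1}) (e : {linear M -> E 0%N}),
    [/\ forall i, injective_module (E i),
        forall i, (n < i)%N -> forall x : E i, x = 0,
        injective e, exact e (d 0%N) & forall i, exact (d i) (d i.+1)].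

Definition submodule (M : lmodType R) (A : set M) : Prop :=
  A 0 /\ forall (c : R) (u v : M), A u -> A v -> A (c *: u + v).

Definition noetherian (M : lmodType R) : Prop :=
  forall A : set M, submodule A ->
  exists (n : nat) (s : 'I_n -> M),
    forall x, A x <-> exists c : 'I_n -> R, x = \sum_i c i *: s i.

(* [d i] is the differential Y_(i+1) -> Y_i, so ker(d_0) lives in           *)
(* Y ((-1) + 1).                                                            *)
Definition Gorenstein_projective (M : lmodType R) : Prop :=
  exists (Y : int -> lmodType R) (d : forall i : int, {linear Y (i + 1) -> Y i}),
    [/\ forall i, projective (Y i),
        forall i, exact (d (i + 1)) (d i),
        forall (P : lmodType R) (i : int) (f : {linear Y (i + 1) -> P}),
          projective P -> (forall y, f (d (i + 1) y) = 0) ->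
          exists g : {linear Y i -> P}, forall y, f y = g (d i y)
      & exists j : {linear M -> Y (-1 + 1)},
          injective j /\ exact j (d (-1))].

Definition GP_cofibration (M N : lmodType R) (f : {linear M -> N}) : Prop :=
  injective f /\
  exists (C : lmodType R) (p : {linear N -> C}),
    [/\ surjective p, exact f p & Gorenstein_projective C].

Definition GP_trivial_cofibration
    (M N : lmodType R) (f : {linear M -> N}) : Prop :=
  injective f /\
  exists (C : lmodType R) (p : {linear N -> C}),
    [/\ surjective p, exact f p & projective C].

Definition GP_trivial_fibration
    (M N : lmodType R) (f : {linear M -> N}) : Prop :=
  surjective f /\
  exists (K : lmodType R) (i : {linear K -> M}),
    [/\ injective i, exact i f & finite_projective_dimension K].

Definition GP_weak_equivalence (M N : lmodType R) (f : {linear M -> N}) : Prop :=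
  exists (L : lmodType R) (i : {linear M -> L}) (p : {linear L -> N}),
    [/\ GP_trivial_cofibration i, GP_trivial_fibration p
      & forall x, f x = p (i x)].

Definition GP_model : model_classes Mod :=
  @ModelClasses Mod GP_cofibration (fun M N f => surjective f)
    GP_weak_equivalence.

End Modules.

(* Right R-modules are left modules over the converse ring R^c.             *)
Definition Gorenstein_ring (R : pzRingType) : Prop :=
  [/\ noetherian (R^o : lmodType R), noetherian (R^c^o : lmodType R^c),
      finite_injective_dimension (R^o : lmodType R)
    & finite_injective_dimension (R^c^o : lmodType R^c)].

HB.mixin Record isTopologicalGroup G of Group G & Topological G := {
  mulg_continuous : continuous (fun x : G * G => (x.1 * x.2)%g);
  invg_continuous : continuous (fun x : G => (x^-1)%g) }.

#[short(type="topologicalGroupType")]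
HB.structure Definition TopologicalGroup :=
  {G of Group G & Topological G & isTopologicalGroup G}.

Section ProP.
Variable G : topologicalGroupType.
Implicit Types P N : set G.

Definition subgroup P : Prop :=
  P 1%g /\ forall x y, P x -> P y -> P (x * y^-1)%g.

Definition hausdorff_subset P : Prop :=
  forall x y, P x -> P y -> x <> y ->
  exists U V : set G, [/\ open U, open V, U x, V y & U `&` V `&` P = set0].

Definition open_subgroup_of P N : Prop :=
  [/\ subgroup N, N `<=` P & exists2 U, open U & N = U `&` P].

Definition normal_in P N : Prop :=
  forall x y, P x -> N y -> N (x * y * x^-1)%g.

Definition left_cosets P N : set (set G) :=
  [set [set (x * y)%g | y in N] | x in P].

(* Profinite (compact, Hausdorff, open subgroups form a base at 1) with all *)
(* open normal subgroups of p-power index.                                  *)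
Definition pro_p (p : nat) P : Prop :=
  [/\ subgroup P, compact P, hausdorff_subset P,
      forall U, nbhs 1%g U -> exists2 N, open_subgroup_of P N & N `<=` U
    & forall N, open_subgroup_of P N -> normal_in P N ->
        exists n, (left_cosets P N #= `I_(p ^ n)%N)%card].

End ProP.

Record open_prop_subgroup (p : nat) (G : topologicalGroupType) :=
  OpenPropSubgroup {
    ops_set :> set G;
    ops_open : open ops_set;
    ops_pro_p : pro_p p ops_set }.

Section TopologicalGroupTheory.
Variable G : topologicalGroupType.

Lemma continuous_mulgl (x : G) : continuous (fun y : G => (x * y)%g).
Proof.
move=> y A nA; have [[/= P Q] [Px Qy] PQA] := mulg_continuous (x, y) A nA.
apply: filterS Qy => z Qz; apply: (PQA (x, z)); split=> //=.
exact: nbhs_singleton.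
Qed.

Lemma nbhs_open_stable (S : set G) :
  (forall x y, S x -> S y -> S (x * y)%g) -> nbhs 1%g S -> open S.
Proof.
move=> SM nS; rewrite openE => x Sx; rewrite /interior.
have /(_ S) := @continuous_mulgl (x^-1)%g x; rewrite mulVg => /(_ nS).
move=> h; have sub : (fun y : G => (x^-1 * y)%g) @^-1` S `<=` S.
  by move=> y /= Sy; rewrite -(mulVKg x y); apply: SM.
by apply: (filterS sub); exact: h.
Qed.

End TopologicalGroupTheory.

Section SmoothRepresentations.
Variables (k : fieldType) (G : topologicalGroupType).

Record smooth_rep := SmoothRep {
  rep_sort :> lmodType k;
  act : G -> rep_sort -> rep_sort;
  act_linear : forall g, linear (act g);
  act1 : forall v, act 1%g v = v;
  actM : forall g h v, act (g * h)%g v = act g (act h v);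
  act_smooth : forall v, open [set g | act g v = v] }.

Record rep_hom (V W : smooth_rep) := RepHom {
  rep_fun :> {linear V -> W};
  rep_funJ : forall g v, rep_fun (act g v) = act g (rep_fun v) }.

Lemma rep_id_subproof (V : smooth_rep) (g : G) (v : V) :
  idfun (act g v) = act g (idfun v).
Proof. by []. Qed.

Definition rep_id (V : smooth_rep) : rep_hom V V :=
  @RepHom V V idfun (@rep_id_subproof V).

Lemma rep_comp_subproof (V W Z : smooth_rep) (b : rep_hom W Z)
  (a : rep_hom V W) (g : G) (v : V) : (b \o a) (act g v) = act g ((b \o a) v).
Proof. by rewrite /= !rep_funJ. Qed.

Definition rep_comp (V W Z : smooth_rep) (b : rep_hom W Z) (a : rep_hom V W) :
  rep_hom V Z := @RepHom V Z (b \o a) (rep_comp_subproof b a).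

Definition Rep : category.
Proof.
refine (@Category smooth_rep rep_hom (fun V W a b => a =1 b) rep_id rep_comp
  _ _ _ _ _ _ _) => //.
- by move=> V W a b ab v; rewrite ab.
- by move=> V W a b c ab bc v; rewrite ab bc.
- by move=> V W Z b b' a a' bb' aa' v /=; rewrite aa' bb'.
Defined.

Section RepTheory.
Variable V : smooth_rep.
Implicit Types (g h : G) (u v : V).

Lemma actD g u v : act g (u + v) = act g u + act g v.
Proof. by have := act_linear g 1 u v; rewrite !scale1r. Qed.

Lemma act0 g : act g (0 : V) = 0.
Proof. by apply: (addrI (act g 0)); rewrite -actD !addr0. Qed.

Lemma actZ g a v : act g (a *: v) = a *: act g v.
Proof. by have := act_linear g a v 0; rewrite !addr0 act0 addr0. Qed.

Lemma actN g v : act g (- v) = - act g v.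
Proof. by rewrite -!scaleN1r actZ. Qed.

Lemma act_sum g I (r : seq I) (F : I -> V) :
  act g (\sum_(i <- r) F i) = \sum_(i <- r) act g (F i).
Proof.
elim: r => [|i r IH]; first by rewrite !big_nil act0.
by rewrite !big_cons actD IH.
Qed.

Definition is_rep_endo : {pred V -> V} :=
  fun f => `[< linear f /\ forall g v, f (act g v) = act g (f v) >].

Lemma rep_endo_zmod_closed : zmod_closed is_rep_endo.
Proof.
split.
  apply/asboolP; split=> [a u v|g v]; last by rewrite act0.
  by rewrite scaler0 addr0.
move=> f h /asboolP[fl fG] /asboolP[hl hG]; apply/asboolP; split.
  move=> a u v; rewrite !fctE fl hl scalerBr opprD -!addrA; congr (_ + _).
  by rewrite addrCA.
by move=> g v; rewrite !fctE fG hG actD actN.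
Qed.

HB.instance Definition _ :=
  GRing.isZmodClosed.Build (V -> V) is_rep_endo rep_endo_zmod_closed.

Record rep_endo := RepEndo { endo_fun :> V -> V; _ : endo_fun \in is_rep_endo }.

HB.instance Definition _ := [isSub for endo_fun].
HB.instance Definition _ := [Choice of rep_endo by <:].
HB.instance Definition _ := [SubChoice_isSubZmodule of rep_endo by <:].

Lemma endo_linear (f : rep_endo) : linear f.
Proof. by case: f => f /= /asboolP[]. Qed.

Lemma endo_act (f : rep_endo) g v : f (act g v) = act g (f v).
Proof. by case: f => f /= /asboolP[]. Qed.

Lemma endo_one_subproof : (idfun : V -> V) \in is_rep_endo.
Proof. exact/asboolP. Qed.

Lemma endo_mul_subproof (f h : rep_endo) : (f \o h : V -> V) \in is_rep_endo.
Proof.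
apply/asboolP; split=> [a u v|g v] /=; first by rewrite !endo_linear.
by rewrite !endo_act.
Qed.

Definition endo_one : rep_endo := RepEndo endo_one_subproof.
Definition endo_mul (f h : rep_endo) : rep_endo := RepEndo (endo_mul_subproof f h).

Lemma endo_ext (f h : rep_endo) : f =1 h -> f = h.
Proof. by move=> fh; apply/val_inj/funext. Qed.

Lemma endo_addE (f h : rep_endo) v : (f + h) v = f v + h v.
Proof. by []. Qed.

Lemma endoD (f : rep_endo) u v : f (u + v) = f u + f v.
Proof. by have := endo_linear f 1 u v; rewrite !scale1r. Qed.

Lemma endo_mulA : associative endo_mul.
Proof. by move=> a b c; apply: endo_ext. Qed.
Lemma endo_mul1f : left_id endo_one endo_mul.
Proof. by move=> a; apply: endo_ext. Qed.
Lemma endo_mulf1 : right_id endo_one endo_mul.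
Proof. by move=> a; apply: endo_ext. Qed.
Lemma endo_mulDl : left_distributive endo_mul +%R.
Proof. by move=> a b c; apply: endo_ext. Qed.
Lemma endo_mulDr : right_distributive endo_mul +%R.
Proof. by move=> a b c; apply: endo_ext => v; rewrite /= endoD. Qed.

HB.instance Definition _ := GRing.Zmodule_isPzRing.Build rep_endo
  endo_mulA endo_mul1f endo_mulf1 endo_mulDl endo_mulDr.

End RepTheory.

End SmoothRepresentations.

Section Induced.
Variables (k : fieldType) (G : topologicalGroupType) (p : nat).
Variable I : open_prop_subgroup p G.
Local Notation Iset := (ops_set I).
Implicit Types (g h x y : G).

Lemma ops1 : Iset 1%g.
Proof. by have [[]] := ops_pro_p I. Qed.

Lemma opsV x : Iset x -> Iset (x^-1)%g.
Proof.
have [[I1 ID] _ _ _ _] := ops_pro_p I.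
by move=> Ix; rewrite -(mul1g x^-1)%g; apply: ID.
Qed.

Lemma opsM x y : Iset x -> Iset y -> Iset (x * y)%g.
Proof.
have [[I1 ID] _ _ _ _] := ops_pro_p I.
by move=> Ix Iy; rewrite -(invgK y)%g; apply: ID => //; apply: opsV.
Qed.

(* Compactly supported functions f : G -> k with f(g i) = f(g).             *)
Definition is_ind : {pred G -> k^o} :=
  fun f => `[< (forall g i, Iset i -> f (g * i)%g = f g) /\
               compact (closure [set g | f g != 0]) >].

Lemma is_ind_submod_closed : submod_closed is_ind.
Proof.
split.
  apply/asboolP; split=> //; rewrite (_ : [set g | _] = set0) ?closure0.
    exact: compact0.
  by rewrite predeqE => g /=; rewrite eqxx.
move=> a u v /asboolP[uI cu] /asboolP[vI cv]; apply/asboolP; split.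
  by move=> g i Ii; rewrite !fctE uI ?vI.
apply: (subclosed_compact (@closed_closure _ _) (compactU cu cv)).
rewrite -closureU; apply: closure_subset => g /=.
have [u0|] := eqVneq (u g) 0; last by left.
have [v0|] := eqVneq (v g) 0; last by right.
by rewrite !fctE u0 v0 scaler0 addr0 eqxx.
Qed.

HB.instance Definition _ :=
  GRing.isSubmodClosed.Build k (G -> k^o) is_ind is_ind_submod_closed.

Record ind := Ind { ind_fun :> G -> k^o; _ : ind_fun \in is_ind }.

HB.instance Definition _ := [isSub for ind_fun].
HB.instance Definition _ := [Choice of ind by <:].
HB.instance Definition _ := [SubChoice_isSubLmodule of ind by <:].

Lemma ind_ext (f f' : ind) : f =1 f' -> f = f'.
Proof. by move=> ff'; apply/val_inj/funext. Qed.

Lemma indI (f : ind) g i : Iset i -> f (g * i)%g = f g.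
Proof. by case: f => f /= /asboolP[fI _]; exact: fI. Qed.

Lemma ind_compact (f : ind) : compact (closure [set g | f g != 0]).
Proof. by case: f => f /= /asboolP[]. Qed.

Lemma ind_act_subproof g (f : ind) :
  ((fun x => f (g^-1 * x)%g) : G -> k^o) \in is_ind.
Proof.
apply/asboolP; split=> [x i Ii|]; first by rewrite mulgA indI.
have cg : compact ((fun x => (g * x)%g) @` closure [set x | f x != 0]).
  apply: continuous_compact; last exact: ind_compact.
  by apply: continuous_subspaceT; exact: continuous_mulgl.
apply: (subclosed_compact (@closed_closure _ _) cg) => x xcl.
exists (g^-1 * x)%g; last by rewrite mulVKg.
move=> B nB; have := xcl _ (@continuous_mulgl _ (g^-1)%g x B nB).
by move=> [y [/= fy By]]; exists (g^-1 * y)%g.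
Qed.

Definition ind_act g (f : ind) : ind := Ind (ind_act_subproof g f).

Lemma ind_act_linear g : linear (ind_act g).
Proof. by move=> a u v; apply: ind_ext. Qed.

Lemma ind_act1 f : ind_act 1%g f = f.
Proof. by apply: ind_ext => x /=; rewrite invg1 mul1g. Qed.

Lemma ind_actM g h f : ind_act (g * h)%g f = ind_act g (ind_act h f).
Proof. by apply: ind_ext => x /=; rewrite invgM mulgA. Qed.

Lemma ind_char_subproof : ((fun x => (x \in Iset)%:R) : G -> k^o) \in is_ind.
Proof.
apply/asboolP; split=> [g i Ii|].
  congr (_%:R); congr nat_of_bool; apply/idP/idP; rewrite !inE => Ig.
    by rewrite -(mulgK i g); apply: opsM => //; apply: opsV.
  exact: opsM.
have cI : compact Iset by have [] := ops_pro_p I.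
have -> : [set g | (g \in Iset)%:R != 0 :> k^o] = Iset.
  rewrite predeqE => g /=; split.
    by case: (boolP (g \in _)) => [/set_mem//|_]; rewrite eqxx.
  by move=> Ig; rewrite mem_set // oner_neq0.
rewrite (_ : closure Iset = Iset) //; apply/esym/closure_id.
rewrite -[X in closed X]setCK; apply: open_closedC.
rewrite openE => g nIg; rewrite /interior.
have nI : nbhs 1%g Iset by apply: open_nbhs_nbhs; split;
  [exact: ops_open|exact: ops1].
have := @continuous_mulgl _ (g^-1)%g g Iset; rewrite mulVg => /(_ nI) n.
have sub : (fun y : G => (g^-1 * y)%g) @^-1` Iset `<=` ~` Iset.
  move=> y /= Iy nIy; apply: nIg.
  have -> : g = (y * (g^-1 * y)^-1)%g by rewrite invgM invgK mulgA mulgV mul1g.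
  by apply: opsM => //; apply: opsV.
by apply: (filterS sub); exact: n.
Qed.

Definition ind_char : ind := Ind ind_char_subproof.

Lemma ind_act_char i : Iset i -> ind_act i ind_char = ind_char.
Proof.
move=> Ii; apply: ind_ext => x /=; congr (_%:R); congr nat_of_bool.
apply/idP/idP; rewrite !inE => Ix.
  by rewrite -(mulVKg i x); apply: opsM.
by apply: opsM => //; apply: opsV.
Qed.

Definition coset_rep g : G := xget 1%g [set h | Iset (g^-1 * h)%g].

Lemma coset_repP g : Iset (g^-1 * coset_rep g)%g.
Proof.
rewrite /coset_rep; case: xgetP => [h _ //|]; move=> /(_ g) [] /=.
by rewrite mulVg; exact: ops1.
Qed.

Lemma eq_coset_rep g h : Iset (g^-1 * h)%g -> coset_rep g = coset_rep h.
Proof.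
move=> Igh; congr xget; rewrite predeqE => x /=; split=> Ix.
  have -> : (h^-1 * x)%g = ((g^-1 * h)^-1 * (g^-1 * x))%g.
    by rewrite invgM invgK -mulgA mulVKg.
  by apply: opsM => //; apply: opsV.
have -> : (g^-1 * x)%g = ((g^-1 * h) * (h^-1 * x))%g.
  by rewrite -mulgA mulVKg.
exact: opsM.
Qed.

Lemma coset_rep_idem g : coset_rep (coset_rep g) = coset_rep g.
Proof. by apply/esym/eq_coset_rep/coset_repP. Qed.

Lemma ind_coset (f : ind) g h : Iset (g^-1 * h)%g -> f h = f g.
Proof. by move=> Igh; rewrite -(indI f g Igh) mulVKg. Qed.

Lemma ind_rep (f : ind) g : f (coset_rep g) = f g.
Proof. exact/ind_coset/coset_repP. Qed.

Lemma ind_finite (f : ind) : exists2 s : seq G,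
  uniq s /\ (forall g, g \in s -> coset_rep g = g) &
  forall g, f g != 0 -> coset_rep g \in s.
Proof.
have /compact_near_coveringP cov := @ind_compact f.
pose F := filter_from [set: {fset G}]
  (fun A : {fset G} => [set B : {fset G} | {subset A <= B}]).
have FF : Filter F.
  apply: filter_from_filter; first by exists fset0.
  move=> A B _ _; exists (A `|` B)%fset => // D sD; split=> x xA; apply: sD.
    by rewrite inE xA.
  by rewrite inE xA orbT.
have [] := cov _ F (fun (A : {fset G}) g => coset_rep g \in A) FF.
  move=> g _.
  have nI : nbhs 1%g Iset by apply: open_nbhs_nbhs; split;
    [exact: ops_open|exact: ops1].
  have := @continuous_mulgl _ (g^-1)%g g Iset; rewrite mulVg.
  move=> /(_ nI) n.
  exists ((fun y => (g^-1 * y)%g) @^-1` Iset,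
          [set B : {fset G} | {subset [fset (coset_rep g)]%fset <= B}]).
    by split=> //=; exists [fset (coset_rep g)]%fset.
  move=> [h A] /= [Igh sA]; apply: sA; rewrite -(eq_coset_rep Igh).
  by rewrite inE.
move=> A _ sA.
exists [seq g <- enum_fset A | coset_rep g == g].
  split; first by rewrite filter_uniq // fset_uniq.
  by move=> g; rewrite mem_filter => /andP[/eqP].
move=> g fg; rewrite mem_filter coset_rep_idem eqxx /=.
by apply: (sA A) => //; apply: subset_closure.
Qed.

Lemma ind_decomp (f : ind) (s : seq G) :
  uniq s -> (forall g, g \in s -> coset_rep g = g) ->
  (forall g, f g != 0 -> coset_rep g \in s) ->
  f = \sum_(g <- s) f g *: ind_act g ind_char.
Proof.
move=> us reps fs; apply: ind_ext => x.
have -> : (\sum_(g <- s) f g *: ind_act g ind_char : ind) x =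
    \sum_(g <- s) f g * ((g^-1 * x)%g \in Iset)%:R.
  elim: s {us reps fs} => [|g s IH]; first by rewrite !big_nil.
  by rewrite !big_cons -IH.
have [fx0|fx] := eqVneq (f x) 0.
  rewrite fx0 big1 // => g _.
  case: (boolP (_ \in _)) => [/set_mem Igx|]; last by rewrite mulr0.
  by rewrite -(ind_coset f Igx) fx0 mul0r.
rewrite (big_rem _ (fs _ fx)) /= ind_rep.
have -> : ((coset_rep x)^-1 * x)%g \in Iset.
  rewrite inE -(invgK ((coset_rep x)^-1 * x))%g; apply: opsV.
  by rewrite invgM invgK; exact: coset_repP.
rewrite mulr1 big_seq big1 ?addr0 // => g.
rewrite mem_rem_uniq // !inE => /andP[/eqP ngx gs].
case: (boolP (_ \in _)) => [/set_mem Igx|]; last by rewrite mulr0.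
by case: ngx; rewrite -(eq_coset_rep Igx) reps.
Qed.

Lemma ind_smooth f : open [set g | ind_act g f = f].
Proof.
apply: nbhs_open_stable => [x y /= fx fy|]; first by rewrite ind_actM fy.
have [s [us reps] fs] := ind_finite f.
rewrite {1}(ind_decomp us reps fs); set F := (F in nbhs _ F).
have -> : F = [set g | ind_act g (\sum_(h <- s) f h *: ind_act h ind_char) =
                       \sum_(h <- s) f h *: ind_act h ind_char].
  by rewrite /F -(ind_decomp us reps fs).
elim: s {us reps fs F} => [|h s IH].
  rewrite (_ : [set g | _] = setT); first exact: filterT.
  rewrite predeqE => g; split=> // _ /=; rewrite !big_nil.
  by apply: ind_ext.
have nI : nbhs 1%g Iset by apply: open_nbhs_nbhs; split;
  [exact: ops_open|exact: ops1].
have nh : nbhs 1%g [set g | Iset (h^-1 * (g * h))%g].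
  have [[P Q] [/= P1 Qh] PQ] : nbhs (1%g : G, h) 
      [set z : G * G | Iset (h^-1 * (z.1 * z.2))%g].
    apply: (mulg_continuous (1%g, h) [set z | Iset (h^-1 * z)%g]) => /=.
    rewrite mul1g; apply: (@continuous_mulgl _ (h^-1)%g h Iset).
    by rewrite mulVg.
  by apply: filterS P1 => g Pg; apply: (PQ (g, h)); split=> //; exact: nbhs_singleton.
apply: filterS (filterI nh IH) => g [/= Igh gs].
rewrite big_cons.
have -> u v : ind_act g (u + v) = ind_act g u + ind_act g v by apply: ind_ext.
congr (_ + _) => //.
have -> a u : ind_act g (a *: u) = a *: ind_act g u by apply: ind_ext.
congr (_ *: _); rewrite -ind_actM.
by rewrite -[in LHS](mulVKg h (g * h))%g ind_actM ind_act_char.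
Qed.

Definition ind_smooth_rep : smooth_rep k G :=
  @SmoothRep k G ind ind_act ind_act_linear ind_act1 ind_actM ind_smooth.

End Induced.

Section Hecke.
Variables (k : fieldType) (G : topologicalGroupType) (p : nat).
Variable I : open_prop_subgroup p G.
Local Notation Iset := (ops_set I).
Local Notation X := (ind_smooth_rep k I).
Implicit Types (g h x y : G).

Definition hecke : pzRingType := (rep_endo X)^c.

(* The underlying endomorphism of X; [hecke_fun (a * b)] is                 *)
(* [hecke_fun b \o hecke_fun a].                                            *)
Definition hecke_fun (a : hecke) : rep_endo X := a.

Lemma hecke_funM (a b : hecke) (f : X) :
  hecke_fun (a * b) f = hecke_fun b (hecke_fun a f).
Proof. by []. Qed.

Section FixedVectors.
Variable V : smooth_rep k G.
Implicit Types (v w : V).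

(* For v in V^I, the G-linear map X -> V sending the characteristic         *)
(* function of I to v, f |-> \sum_(gI in G/I) f(g) (g v).                   *)
Definition frob v (f : X) : V :=
  \sum_(g \in [set g | coset_rep I g = g]) f g *: act g v.

Lemma frobE v (f : X) (s : seq G) :
  uniq s -> (forall g, g \in s -> coset_rep I g = g) ->
  (forall g, f g != 0 -> coset_rep I g \in s) ->
  frob v f = \sum_(g <- s) f g *: act g v.
Proof.
move=> us reps fs.
transitivity (\sum_(g <- s | g \in [set g | coset_rep I g = g]) f g *: act g v).
  apply: fsbigE => // g /= repg gs.
  have [->|fg] := eqVneq (f g) 0; first by rewrite scale0r.
  by have := fs g fg; rewrite repg (negbTE gs).
rewrite big_seq_cond [RHS]big_seq; apply: eq_bigl => g.
by case: (boolP (g \in s)) => //= gs; apply/mem_set/reps.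
Qed.

Lemma frob_linear v : linear (frob v).
Proof.
move=> a f f'; have [s1 [us1 rep1] s1P] := ind_finite f.
have [s2 [us2 rep2] s2P] := ind_finite f'.
have us := undup_uniq (s1 ++ s2).
have reps g : g \in undup (s1 ++ s2) -> coset_rep I g = g.
  by rewrite mem_undup mem_cat => /orP[/rep1|/rep2].
rewrite !(frobE _ us reps).
- rewrite scaler_sumr -big_split /=; apply: eq_bigr => g _.
  by rewrite scalerA -scalerDl.
- by move=> g fg; rewrite mem_undup mem_cat s2P // orbT.
- by move=> g fg; rewrite mem_undup mem_cat s1P.
move=> g; rewrite mem_undup mem_cat.
have [f0|/s1P -> //] := eqVneq (f g) 0.
have [f0'|/s2P -> //] := eqVneq (f' g) 0; last by rewrite orbT.
have -> : (a *: f + f' : X) g = a * f g + f' g by [].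
by rewrite f0 f0' mulr0 addr0 eqxx.
Qed.

Definition is_fixed : {pred V} :=
  fun v => `[< forall i, Iset i -> act i v = v >].

Lemma frob_char v g : v \in is_fixed ->
  frob v (act g (ind_char k I : X)) = act g v.
Proof.
move=> /asboolP vI; rewrite (@frobE _ _ [:: coset_rep I g]) //.
- rewrite big_seq1 /= mem_set; last exact: coset_repP.
  rewrite scale1r -{1}(mulVKg g (coset_rep I g)) actM vI //.
  exact: coset_repP.
- by move=> h; rewrite inE => /eqP ->; exact: coset_rep_idem.
move=> h /=; case: (boolP (_ \in _)) => [/set_mem Igh _|]; last by rewrite eqxx.
by rewrite inE (eq_coset_rep Igh).
Qed.

Lemma ind_hom_ext (W : lmodType k) (a b : X -> W) : linear a -> linear b ->
  (forall g, a (act g (ind_char k I : X)) = b (act g (ind_char k I : X))) ->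
  a =1 b.
Proof.
move=> al bl ab f; have [s [us reps] fs] := ind_finite f.
have add0 (c : X -> W) : linear c -> c 0 = 0.
  by move=> cl; apply: (addrI (c 0)); have := cl 1 0 0; rewrite !scale1r !addr0.
rewrite (ind_decomp us reps fs); elim: s {us reps fs} => [|g s IH].
  by rewrite !big_nil !add0.
by rewrite big_cons al bl; congr (_ *: _ + _); [exact: ab|exact: IH].
Qed.

Lemma frob_act v g (f : X) : v \in is_fixed ->
  frob v (act g f) = act g (frob v f).
Proof.
move=> vI; move: f; apply: ind_hom_ext => [a f f'|a f f'|h].
- by rewrite act_linear frob_linear.
- by rewrite frob_linear act_linear.
by rewrite -actM !frob_char // actM.
Qed.

Lemma frob1 v : v \in is_fixed -> frob v (ind_char k I : X) = v.
Proof. by move=> vI; rewrite -{1}(act1 (ind_char k I : X)) frob_char // act1. Qed.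

Lemma frob_uniq v (a : X -> V) : v \in is_fixed -> linear a ->
  (forall g f, a (act g f) = act g (a f)) -> a (ind_char k I : X) = v ->
  a =1 frob v.
Proof.
move=> vI al aG av; apply: ind_hom_ext => // [|g]; first exact: frob_linear.
by rewrite aG av frob_char.
Qed.

Lemma is_fixed_zmod_closed : zmod_closed is_fixed.
Proof.
split; first by apply/asboolP => i _; rewrite act0.
move=> u v /asboolP uI /asboolP vI; apply/asboolP => i Ii.
by rewrite actD actN uI // vI.
Qed.

HB.instance Definition _ :=
  GRing.isZmodClosed.Build V is_fixed is_fixed_zmod_closed.

Record fixed := Fixed { fixed_val :> V; _ : fixed_val \in is_fixed }.

HB.instance Definition _ := [isSub for fixed_val].
HB.instance Definition _ := [Choice of fixed by <:].
HB.instance Definition _ := [SubChoice_isSubZmodule of fixed by <:].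

Lemma fixedP (v : fixed) : (v : V) \in is_fixed.
Proof. by case: v. Qed.

Lemma char_fixed (a : hecke) i : Iset i ->
  act i (hecke_fun a (ind_char k I : X)) = hecke_fun a (ind_char k I : X).
Proof.
by move=> Ii; rewrite -endo_act; apply: f_equal; exact: ind_act_char.
Qed.

Lemma fixed_scale_subproof (a : hecke) (v : fixed) :
  frob v (hecke_fun a (ind_char k I : X)) \in is_fixed.
Proof.
by apply/asboolP => i Ii; rewrite -frob_act ?fixedP // char_fixed.
Qed.

(* The action of H on V^I = Hom_G(X, V) by composition.                     *)
Definition fixed_scale (a : hecke) (v : fixed) : fixed :=
  Fixed (fixed_scale_subproof a v).

Lemma frob_scale (a : hecke) (v : fixed) (f : X) :
  frob (fixed_scale a v) f = frob v (hecke_fun a f).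
Proof.
have vI := fixedP v.
move: f; apply/fsym/frob_uniq => [|b f f'|g f|//].
- exact: fixedP.
- by rewrite endo_linear frob_linear.
by rewrite endo_act frob_act.
Qed.

Lemma frobD (u v : fixed) (f : X) : frob (u + v : fixed) f = frob u f + frob v f.
Proof.
move: f; apply/fsym/frob_uniq => [|b f f'|g f|].
- exact: fixedP.
- by rewrite !frob_linear scalerDr addrACA.
- by rewrite !frob_act ?fixedP // actD.
by rewrite !frob1 ?fixedP.
Qed.

Lemma fixed_ext (u v : fixed) : u = v :> V -> u = v.
Proof. by move=> uv; apply: val_inj. Qed.

Lemma fixed_scalerA (a b : hecke) (v : fixed) :
  fixed_scale a (fixed_scale b v) = fixed_scale (a * b) v.
Proof. by apply: fixed_ext; rewrite /= frob_scale -hecke_funM. Qed.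

Lemma fixed_scale1r : left_id 1 fixed_scale.
Proof. by move=> v; apply: fixed_ext; rewrite /= frob1 ?fixedP. Qed.

Lemma fixed_scalerDr : right_distributive fixed_scale +%R.
Proof. by move=> a u v; apply: fixed_ext; rewrite /= frobD. Qed.

Lemma fixed_scalerDl (v : fixed) : {morph fixed_scale^~ v : a b / a + b}.
Proof.
move=> a b; apply: fixed_ext.
have := frob_linear v 1 (hecke_fun a (ind_char k I : X))
  (hecke_fun b (ind_char k I : X)).
by rewrite !scale1r.
Qed.

HB.instance Definition _ := GRing.Zmodule_isLmodule.Build hecke fixed
  fixed_scalerA fixed_scale1r fixed_scalerDr fixed_scalerDl.

End FixedVectors.

Section FixedMorphism.
Variables (V W : smooth_rep k G) (b : rep_hom V W).

Lemma fixed_map_subproof (v : fixed V) : b (fixed_val v) \in @is_fixed W.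
Proof.
apply/asboolP => i Ii; rewrite -rep_funJ; congr (rep_fun b _).
by have /asboolP := fixedP v; apply.
Qed.

Definition fixed_map (v : fixed V) : fixed W := Fixed (fixed_map_subproof v).

Lemma fixed_map_linear : linear fixed_map.
Proof.
move=> a u v; apply: fixed_ext; rewrite /= linearD; congr (_ + _).
have := @frob_uniq W (fixed_map u) (b \o frob u) (fixedP _).
move=> /(_ _ _ _ (hecke_fun a (ind_char k I : X))); apply.
- by move=> c f f'; rewrite /= frob_linear linearP.
- by move=> g f; rewrite /= frob_act ?fixedP // rep_funJ.
by rewrite /= frob1 ?fixedP.
Qed.

HB.instance Definition _ :=
  GRing.isLinear.Build hecke (fixed V) (fixed W) _ fixed_map fixed_map_linear.

End FixedMorphism.

Definition functor_U : functor (Rep k G) (Mod hecke).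
Proof.
refine (@Functor (Rep k G) (Mod hecke) (fun V => (fixed V : lmodType hecke))
  (fun V W b => (fixed_map b : {linear fixed V -> fixed W})) _ _ _).
- by move=> V W b c bc v; apply: fixed_ext; exact: bc.
- by move=> V v; apply: fixed_ext.
- by move=> V W Z c b v; apply: fixed_ext.
Defined.

End Hecke.

Section QuotientModule.
Variables (k : pzRingType) (V : lmodType k) (S : zmodClosed V).
Hypothesis SZ : forall (c : k) v, v \in S -> c *: v \in S.
Local Open Scope quotient_scope.

Definition quotient_module of (forall (c : k) v, v \in S -> c *: v \in S) : Type :=
  ring_quotient.Quotient.quot S.
Local Notation lquot := (quotient_module SZ).

HB.instance Definition _ :=
  GRing.Zmodule.copy lquot (ring_quotient.Quotient.quot S).

Definition lpi (v : V) : lquot := \pi_(ring_quotient.Quotient.quot S) v.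

Lemma lpiD u v : lpi (u + v) = lpi u + lpi v.
Proof. by rewrite /lpi piE. Qed.

Definition lrepr (q : lquot) : V := repr (q : ring_quotient.Quotient.quot S).

Lemma lreprK q : lpi (lrepr q) = q.
Proof. by rewrite /lpi /lrepr reprK. Qed.

Lemma lpi_repr (q : lquot) : exists v, q = lpi v.
Proof. by exists (lrepr q); rewrite lreprK. Qed.

Lemma lpi_eq u v : lpi u = lpi v <-> u - v \in S.
Proof.
split=> [uv|]; first by rewrite ring_quotient.Quotient.idealrBE; apply/eqP.
by rewrite ring_quotient.Quotient.idealrBE => /eqP.
Qed.

Definition lquot_scale (c : k) (q : lquot) : lquot := lpi (c *: lrepr q).

Lemma lquot_scale_pi c v : lquot_scale c (lpi v) = lpi (c *: v).
Proof.
apply/lpi_eq; rewrite -scalerBr; apply: SZ; apply/lpi_eq.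
by rewrite lreprK.
Qed.

Lemma lquot_scalerA a b q : lquot_scale a (lquot_scale b q) = lquot_scale (a * b) q.
Proof. by have [v ->] := lpi_repr q; rewrite !lquot_scale_pi scalerA. Qed.

Lemma lquot_scale1r : left_id 1 lquot_scale.
Proof. by move=> q; have [v ->] := lpi_repr q; rewrite lquot_scale_pi scale1r. Qed.

Lemma lquot_scalerDr : right_distributive lquot_scale +%R.
Proof.
move=> a q r; have [u ->] := lpi_repr q; have [v ->] := lpi_repr r.
by rewrite -lpiD !lquot_scale_pi scalerDr lpiD.
Qed.

Lemma lquot_scalerDl q : {morph lquot_scale^~ q : a b / a + b}.
Proof.
by move=> a b; have [v ->] := lpi_repr q; rewrite !lquot_scale_pi scalerDl lpiD.
Qed.

HB.instance Definition _ := GRing.Zmodule_isLmodule.Build k lquot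
  lquot_scalerA lquot_scale1r lquot_scalerDr lquot_scalerDl.

Lemma lpiZ c v : lpi (c *: v) = c *: lpi v.
Proof. by rewrite -lquot_scale_pi. Qed.

Lemma lpi_linear : linear lpi.
Proof. by move=> c u v; rewrite lpiD -lquot_scale_pi. Qed.

HB.instance Definition _ := GRing.isLinear.Build k V lquot _ lpi lpi_linear.

End QuotientModule.

Section FreeModule.
Variables (k : fieldType) (K : choiceType).

Definition is_free : {pred K -> k^o} :=
  fun f => `[< finite_set [set x | f x != 0] >].

Lemma is_free_submod_closed : submod_closed is_free.
Proof.
split.
  apply/asboolP; rewrite (_ : [set x | _] = set0); first exact: finite_set0.
  by rewrite predeqE => x /=; rewrite eqxx.
move=> c u v /asboolP uf /asboolP vf; apply/asboolP.
have uvf : finite_set ([set x | u x != 0] `|` [set x | v x != 0]).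
  by rewrite finite_setU.
apply: sub_finite_set uvf => x /=.
have [u0|] := eqVneq (u x) 0; last by left.
have [v0|] := eqVneq (v x) 0; last by right.
by rewrite !fctE u0 v0 scaler0 addr0 eqxx.
Qed.

HB.instance Definition _ :=
  GRing.isSubmodClosed.Build k (K -> k^o) is_free is_free_submod_closed.

Record free_module := Free { free_fun :> K -> k^o; _ : free_fun \in is_free }.

HB.instance Definition _ := [isSub for free_fun].
HB.instance Definition _ := [Choice of free_module by <:].
HB.instance Definition _ := [SubChoice_isSubLmodule of free_module by <:].

Lemma free_ext (u v : free_module) : u =1 v -> u = v.
Proof. by move=> uv; apply/val_inj/funext. Qed.

Lemma free_basis_subproof (x : K) :
  ((fun y => (y == x)%:R) : K -> k^o) \in is_free.
Proof.
apply/asboolP; apply: (@sub_finite_set _ _ [set x]); last exact: finite_set1.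
by move=> y /=; case: (eqVneq y x) => // _; rewrite eqxx.
Qed.

Definition free_basis (x : K) : free_module := Free (free_basis_subproof x).

Lemma free_supp (u : free_module) :
  exists2 s : seq K, uniq s & forall x, u x != 0 -> x \in s.
Proof.
case: u => u /= /asboolP uf; exists (fset_set [set x | u x != 0]).
  exact: fset_uniq.
by move=> x ux; rewrite in_fset_set // inE.
Qed.

Lemma free_decomp (u : free_module) (s : seq K) : uniq s ->
  (forall x, u x != 0 -> x \in s) -> u = \sum_(x <- s) u x *: free_basis x.
Proof.
move=> us su; apply: free_ext => y.
have -> : (\sum_(x <- s) u x *: free_basis x : free_module) y =
    \sum_(x <- s) u x * (y == x)%:R.
  elim: s {us su} => [|x s IH]; first by rewrite !big_nil.
  by rewrite !big_cons -IH.
have [uy0|/su ys] := eqVneq (u y) 0.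
  rewrite uy0 big1 // => x _; have [<-|_] := eqVneq y x; last by rewrite mulr0.
  by rewrite uy0 mul0r.
rewrite (big_rem _ ys) /= eqxx mulr1 big_seq big1 ?addr0 // => x.
by rewrite mem_rem_uniq // !inE => /andP[/negbTE]; rewrite eq_sym => ->; rewrite mulr0.
Qed.

Lemma free_ind (P : free_module -> Prop) : P 0 ->
  (forall c x u, P u -> P (c *: free_basis x + u)) -> forall u, P u.
Proof.
move=> P0 PD u; have [s us su] := free_supp u.
rewrite (free_decomp us su); elim: s {us su} => [|x s IH].
  by rewrite big_nil.
by rewrite big_cons; exact: PD.
Qed.

Variables (W : lmodType k) (b : K -> W).

Definition free_lift (u : free_module) : W := \sum_(x \in setT) u x *: b x.

Lemma free_liftE (u : free_module) (s : seq K) : uniq s ->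
  (forall x, u x != 0 -> x \in s) -> free_lift u = \sum_(x <- s) u x *: b x.
Proof.
move=> us su; transitivity (\sum_(x <- s | x \in [set: K]) u x *: b x).
  apply: fsbigE => // x _ xs; have [->|/su] := eqVneq (u x) 0.
    by rewrite scale0r.
  by rewrite (negbTE xs).
by apply: eq_bigl => x; rewrite in_setT.
Qed.

Lemma free_lift_linear : linear free_lift.
Proof.
move=> c u v; have [s1 us1 su1] := free_supp u; have [s2 us2 su2] := free_supp v.
have us := undup_uniq (s1 ++ s2).
rewrite !(free_liftE us).
- rewrite scaler_sumr -big_split /=; apply: eq_bigr => x _.
  by rewrite scalerA -scalerDl.
- by move=> x /su2; rewrite mem_undup mem_cat orbC => ->.
- by move=> x /su1; rewrite mem_undup mem_cat => ->.
move=> x; rewrite mem_undup mem_cat.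
have [u0|/su1 -> //] := eqVneq (u x) 0.
have [v0|/su2 -> //] := eqVneq (v x) 0; last by rewrite orbT.
have -> : (c *: u + v : free_module) x = c * u x + v x by [].
by rewrite u0 v0 mulr0 addr0 eqxx.
Qed.

HB.instance Definition _ :=
  GRing.isLinear.Build k free_module W _ free_lift free_lift_linear.

Lemma free_lift_basis x : free_lift (free_basis x) = b x.
Proof.
rewrite (@free_liftE _ [:: x]) ?big_seq1 /= ?eqxx ?scale1r // => y.
by rewrite inE; case: (eqVneq y x) => // _; rewrite eqxx.
Qed.

End FreeModule.

Arguments free_basis {k K} x.

Section Tensor.
Variables (k : fieldType) (G : topologicalGroupType) (p : nat).
Variable I : open_prop_subgroup p G.
Local Notation X := (ind_smooth_rep k I).
Local Notation H := (hecke k I).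

Section TensorProduct.
Variable M : lmodType H.

Definition tensor_free : lmodType k := free_module k (ind k I * M)%type.

Implicit Types (x y : X) (m n : M) (u v : tensor_free).

Definition delta x m : tensor_free := free_basis (x : ind k I, m).

(* X is a right H-module by x h := h(x).                                    *)
Inductive tensor_relator : tensor_free -> Prop :=
  | tensor_addl x y m : tensor_relator (delta (x + y) m - delta x m - delta y m)
  | tensor_addr x m n : tensor_relator (delta x (m + n) - delta x m - delta x n)
  | tensor_scale c x m : tensor_relator (delta (c *: x) m - c *: delta x m)
  | tensor_balance x (h : H) m :
      tensor_relator (delta (hecke_fun h x) m - delta x (h *: m)).

Definition tensor_relations : {pred tensor_free} :=
  fun u => `[< forall B : set tensor_free,
    submodule B -> (forall v, tensor_relator v -> B v) -> B u >].

Lemma tensor_relations_lin (c : k) u v :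
  u \in tensor_relations -> v \in tensor_relations ->
  c *: u + v \in tensor_relations.
Proof.
move=> /asboolP uR /asboolP vR; apply/asboolP => B Bsub BR.
by apply: Bsub.2; [exact: uR|exact: vR].
Qed.

Lemma tensor_relations_zmod_closed : zmod_closed tensor_relations.
Proof.
split=> [|u v uR vR]; first by apply/asboolP => B [].
by rewrite -scaleN1r addrC; exact: tensor_relations_lin.
Qed.

Lemma tensor_relationsZ (c : k) u :
  u \in tensor_relations -> c *: u \in tensor_relations.
Proof.
move=> uR; rewrite -[_ *: _]addr0; apply: tensor_relations_lin => //.
exact: tensor_relations_zmod_closed.1.
Qed.

HB.instance Definition _ := GRing.isZmodClosed.Build tensor_free
  tensor_relations tensor_relations_zmod_closed.

Definition tensor : lmodType k := quotient_module tensor_relationsZ.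

Definition pure x m : tensor := lpi tensor_relationsZ (delta x m).

Lemma tensor_relatorP u : tensor_relator u -> u \in tensor_relations.
Proof. by move=> uR; apply/asboolP => B _; apply. Qed.

Lemma pureDl x y m : pure (x + y) m = pure x m + pure y m.
Proof.
rewrite -lpiD; apply/lpi_eq; rewrite opprD addrA.
exact/tensor_relatorP/tensor_addl.
Qed.

Lemma pureDr x m n : pure x (m + n) = pure x m + pure x n.
Proof.
rewrite -lpiD; apply/lpi_eq; rewrite opprD addrA.
exact/tensor_relatorP/tensor_addr.
Qed.

Lemma pureZ c x m : pure (c *: x) m = c *: pure x m.
Proof.
by rewrite -lpiZ; apply/lpi_eq; exact/tensor_relatorP/tensor_scale.
Qed.

Lemma pure_balance x (h : H) m : pure (hecke_fun h x) m = pure x (h *: m).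
Proof. by apply/lpi_eq; exact/tensor_relatorP/tensor_balance. Qed.

Lemma tensor_ind (P : tensor -> Prop) :
  P 0 -> (forall c x m t, P t -> P (c *: pure x m + t)) -> forall t, P t.
Proof.
move=> P0 PD t; have [u ->] := lpi_repr t; move: u; apply: free_ind.
  by rewrite raddf0.
by move=> c [x m] u IH; rewrite lpiD lpiZ; exact: PD.
Qed.

Definition balanced (W : lmodType k) (b : X -> M -> W) : Prop :=
  [/\ forall x y m, b (x + y) m = b x m + b y m,
      forall x m n, b x (m + n) = b x m + b x n,
      forall c x m, b (c *: x) m = c *: b x m
    & forall x (h : H) m, b (hecke_fun h x) m = b x (h *: m)].

Section Lift.
Variables (W : lmodType k) (b : X -> M -> W).
Hypothesis bal : balanced b.

Definition tensor_lift (t : tensor) : W :=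
  free_lift (fun z : ind k I * M => b z.1 z.2) (lrepr t).

Lemma tensor_lift_pi u : tensor_lift (lpi tensor_relationsZ u) =
  free_lift (fun z : ind k I * M => b z.1 z.2) u.
Proof.
have [l lf] : exists l : {linear tensor_free -> W},
    forall v, free_lift (fun z : ind k I * M => b z.1 z.2) v = l v.
  by exists (free_lift (fun z : ind k I * M => b z.1 z.2)).
have lE x m : l (delta x m) = b x m by rewrite -lf free_lift_basis.
rewrite /tensor_lift !lf.
suff : l (lrepr (lpi tensor_relationsZ u) - u) = 0.
  by rewrite linearB => /eqP; rewrite subr_eq0 => /eqP.
have : lrepr (lpi tensor_relationsZ u) - u \in tensor_relations.
  by apply/(lpi_eq tensor_relationsZ); rewrite lreprK.
move=> /asboolP /(_ [set v | l v = 0]); apply.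
  split=> [|c v w /= v0 w0]; first exact: linear0.
  by rewrite linearP v0 w0 scaler0 addr0.
case: bal => bDl bDr bZ bb v; case=> [x y m|x m n|c x m|x h m] /=.
- by rewrite !linearB !lE bDl addrAC addrK subrr.
- by rewrite !linearB !lE bDr addrAC addrK subrr.
- by rewrite linearB linearZ !lE bZ subrr.
by rewrite linearB !lE bb subrr.
Qed.

Lemma tensor_lift_linear : linear tensor_lift.
Proof.
move=> c s t; have [u ->] := lpi_repr s; have [v ->] := lpi_repr t.
by rewrite -lpi_linear !tensor_lift_pi free_lift_linear.
Qed.

Lemma tensor_lift_pure x m : tensor_lift (pure x m) = b x m.
Proof. by rewrite /pure tensor_lift_pi free_lift_basis. Qed.

End Lift.

Lemma tensor_ext (W : lmodType k) (a b : tensor -> W) : linear a -> linear b ->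
  (forall x m, a (pure x m) = b (pure x m)) -> a =1 b.
Proof.
move=> al bl ab; apply: tensor_ind => [|c x m t IH].
  have add0 (c : tensor -> W) : linear c -> c 0 = 0.
    by move=> cl; apply: (addrI (c 0)); have := cl 1 0 0; rewrite !scale1r !addr0.
  by rewrite !add0.
by rewrite al bl ab IH.
Qed.

Definition tensor_act (g : G) : tensor -> tensor :=
  tensor_lift (fun x m => pure (act g x) m).

Lemma tensor_act_balanced g : balanced (fun x m => pure (act g x) m).
Proof.
split=> [x y m|x m n|c x m|x h m].
- by rewrite actD pureDl.
- by rewrite pureDr.
- by rewrite actZ pureZ.
by rewrite -pure_balance endo_act.
Qed.

Lemma tensor_act_linear g : linear (tensor_act g).
Proof. exact/tensor_lift_linear/tensor_act_balanced. Qed.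

Lemma tensor_act_pure g x m : tensor_act g (pure x m) = pure (act g x) m.
Proof. exact/tensor_lift_pure/tensor_act_balanced. Qed.

Lemma tensor_act1 t : tensor_act 1%g t = t.
Proof.
move: t; apply: (@tensor_ext _ _ id) => [||x m]; first exact: tensor_act_linear.
  by [].
by rewrite tensor_act_pure act1.
Qed.

Lemma tensor_actM g h t : tensor_act (g * h)%g t = tensor_act g (tensor_act h t).
Proof.
move: t; apply: tensor_ext => [|c s t|x m]; first exact: tensor_act_linear.
  by rewrite !tensor_act_linear.
by rewrite !tensor_act_pure actM.
Qed.

Lemma tensor_smooth t : open [set g | tensor_act g t = t].
Proof.
apply: nbhs_open_stable => [x y /= tx ty|]; first by rewrite tensor_actM ty.
move: t; apply: tensor_ind => [|c x m t IH].
  have -> : [set g | tensor_act g 0 = 0] = setT; last exact: filterT.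
  rewrite predeqE => g; split=> // _ /=; apply: (addrI (tensor_act g 0)).
  by have := tensor_act_linear g 1 0 0; rewrite !scale1r !addr0.
have nx : nbhs 1%g [set g | act g x = x].
  by apply: open_nbhs_nbhs; split; [exact: act_smooth|exact: act1].
apply: filterS (filterI nx IH) => g [gx gt].
by rewrite /= tensor_act_linear tensor_act_pure [act g x]gx gt.
Qed.

Definition tensor_rep : smooth_rep k G :=
  @SmoothRep k G tensor tensor_act tensor_act_linear tensor_act1 tensor_actM
    tensor_smooth.

End TensorProduct.

Section TensorMorphism.
Variables (M N : lmodType H) (f : {linear M -> N}).

Lemma tensor_map_balanced : balanced (fun x m => pure x (f m)).
Proof.
split=> [x y m|x m n|c x m|x h m].
- by rewrite pureDl.
- by rewrite raddfD pureDr.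
- by rewrite pureZ.
by rewrite pure_balance linearZ.
Qed.

Definition tensor_fun : tensor M -> tensor N :=
  tensor_lift (fun x m => pure x (f m)).

Lemma tensor_fun_linear : linear tensor_fun.
Proof. exact/tensor_lift_linear/tensor_map_balanced. Qed.

HB.instance Definition _ :=
  GRing.isLinear.Build k (tensor M) (tensor N) _ tensor_fun tensor_fun_linear.

Lemma tensor_fun_pure x m : tensor_fun (pure x m) = pure x (f m).
Proof. exact/tensor_lift_pure/tensor_map_balanced. Qed.

Lemma tensor_fun_act g (t : tensor_rep M) :
  tensor_fun (act g t) = (act g (tensor_fun t : tensor_rep N)).
Proof.
move: t; apply: tensor_ext => [c s t|c s t|x m].
- by rewrite act_linear linearP.
- by rewrite tensor_fun_linear act_linear.
by rewrite /= tensor_act_pure !tensor_fun_pure tensor_act_pure.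
Qed.

Definition tensor_map : rep_hom (tensor_rep M) (tensor_rep N) :=
  @RepHom k G (tensor_rep M) (tensor_rep N) tensor_fun tensor_fun_act.

End TensorMorphism.

Definition functor_F : functor (Mod H) (Rep k G).
Proof.
refine (@Functor (Mod H) (Rep k G) tensor_rep tensor_map _ _ _).
- move=> M N f g fg; apply: tensor_ext => [||x m]; try exact: tensor_fun_linear.
  by rewrite /= !tensor_fun_pure fg.
- move=> M; apply: (@tensor_ext M _ _ id) => [||x m] //.
    exact: tensor_fun_linear.
  by rewrite /= tensor_fun_pure.
- move=> M N P g f.
  apply: (@tensor_ext M _ _ (tensor_fun g \o tensor_fun f)) => [|c s t|x m].
  + exact: tensor_fun_linear.
  + by rewrite /= !tensor_fun_linear.
  by rewrite /= !tensor_fun_pure.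
Defined.

Definition I_GP_model : model_classes (Rep k G) :=
  right_transfer (GP_model H) (functor_U k I).

End Tensor.

(* Main.v *)
Require Import Defs.
From HB Require Import structures.
From mathcomp Require Import all_boot all_order all_algebra.
From mathcomp Require Import boolp classical_sets topology.
From mathcomp Require Import finmap functions cardinality.
Import Defs.

(* A Gorenstein projective M sits in an exact sequence 0 -> M -> P0 -> P1     *)
(* with P0, P1 projective, and the unit P -> UFP is bijective for P           *)
(* projective by a dual basis argument. As U is left exact, it sends the      *)
(* representation V = ker(FP0 -> FP1) to ker(P0 -> P1) = M; hence RU is       *)
(* essentially surjective. The maps UFM -> ker(UFP0 -> UFP1) = M retract the  *)
(* unit. Since U preserves all weak equivalences it descends to a functor U'  *)
(* on homotopy categories, and the unit on cofibrant replacements gives a     *)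
(* natural split monomorphism id -> U' LF, so LF is faithful.                 *)

Set Implicit Arguments.
Unset Strict Implicit.
Unset Printing Implicit Defensive.

Import GRing.Theory.
Local Open Scope classical_set_scope.
Local Open Scope ring_scope.

(** Everything happens on cofibrant modules M. Such an M is the kernel of a map [d] : P0 -> P1 of
    projectives ([cofibrant_copresentation]). For P projective, a dual basis reduces the unit P ->
    UFP, m |-> 1_I (x) m, to the identification of H with X^I, so the unit is bijective
    ([unit_injective], [unit_surjective]). Hence M is identified with ker(UFP0 -> UFP1)
    ([unit_kernel]).

    F need not preserve this kernel, so FM may differ from V = ker(FP0 -> FP1), and the two halves
    of the theorem use the kernel differently. As U is left exact, UV = M
    ([fixed_kernel_isomorphic]), which gives essential surjectivity of RU. As FM -> FP0 lands in V,
    the map UFM -> UV = M retracts the unit of M ([unit_retraction]).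

    Since weak equivalences of representations are detected by U, the functor U localizes to some U'
    without fibrant replacement. The units of the cofibrant replacements QM yield a natural
    transformation id -> U' LF whose components are split monomorphisms, and this makes LF faithful
    ([split_unit_faithful]); the splittings need not be natural. *)

(** * Isomorphisms, split monomorphisms and commutative squares up to [eqh] *)

Section Isomorphisms.
Variable C : category.

Lemma isomorphic_sym (a b : C) : isomorphic a b -> isomorphic b a.
Proof. by move=> [f [g [gf fg]]]; exists g, f. Qed.

Lemma isomorphic_trans (a b c : C) :
  isomorphic a b -> isomorphic b c -> isomorphic a c.
Proof.
move=> [f [f' [f'f ff']]] [g [g' [g'g gg']]]; exists (g \oc f), (f' \oc g').
have cancel x y z (u : hom x y) (u' : hom y x) (v : hom z x) (v' : hom x z) :
    u' \oc u =h idh x -> v' \oc v =h idh z ->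
    (v' \oc u') \oc (u \oc v) =h idh z.
  move=> u'u v'v; apply: eqh_trans v'v; apply: eqh_trans (comphA _ _ _) _.
  apply: comph_eqh (eqh_refl _); apply: eqh_trans (eqh_sym (comphA _ _ _)) _.
  by apply: eqh_trans (comph_eqh (eqh_refl _) u'u) (comph1 _).
by split; exact: cancel.
Qed.

(** Turns a square around along its vertical sides. It serves to invert natural isomorphisms and to
    pass from a weak equivalence to its formal inverse. *)
Lemma iso_square_inv (a b c d : C) (f : hom a b) (g : hom c d)
    (t : hom a c) (t' : hom c a) (u : hom b d) (u' : hom d b) :
  t \oc t' =h idh c -> u' \oc u =h idh b ->
  u \oc f =h g \oc t -> f \oc t' =h u' \oc g.
Proof.
move=> tt' u'u sq.
apply: eqh_trans (eqh_sym (comp1h _)) _.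
apply: eqh_trans (comph_eqh (eqh_sym u'u) (eqh_refl _)) _.
apply: eqh_trans (eqh_sym (comphA _ _ _)) _.
apply: comph_eqh; first exact: eqh_refl.
apply: eqh_trans (comphA _ _ _) _.
apply: eqh_trans (comph_eqh sq (eqh_refl _)) _.
apply: eqh_trans (eqh_sym (comphA _ _ _)) _.
exact: eqh_trans (comph_eqh (eqh_refl _) tt') (comph1 _).
Qed.

Lemma square_paste (a b c a' b' c' : C) (f : hom a b) (g : hom b c)
    (f' : hom a' b') (g' : hom b' c')
    (s : hom a a') (t : hom b b') (u : hom c c') :
  t \oc f =h f' \oc s -> u \oc g =h g' \oc t ->
  u \oc (g \oc f) =h (g' \oc f') \oc s.
Proof.
move=> sq1 sq2; apply: eqh_trans (comphA _ _ _) _.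
apply: eqh_trans (comph_eqh sq2 (eqh_refl _)) _.
apply: eqh_trans (eqh_sym (comphA _ _ _)) _.
apply: eqh_trans (comph_eqh (eqh_refl _) sq1) _.
exact: comphA.
Qed.

Definition split_mono (a b : C) (f : hom a b) : Prop :=
  exists s : hom b a, s \oc f =h idh a.

Lemma split_mono_comp (a b c : C) (f : hom a b) (g : hom b c) :
  split_mono f -> split_mono g -> split_mono (g \oc f).
Proof.
move=> [f' f'f] [g' g'g]; exists (f' \oc g').
apply: eqh_trans f'f; apply: eqh_trans (eqh_sym (comphA _ _ _)) _.
apply: comph_eqh (eqh_refl _) _; apply: eqh_trans (comphA _ _ _) _.
exact: eqh_trans (comph_eqh g'g (eqh_refl _)) (comp1h _).
Qed.

End Isomorphisms.

Lemma split_mono_fhom (C D : category) (F : functor C D) (a b : C)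
  (f : hom a b) : split_mono f -> split_mono (fhom F f).
Proof.
move=> [s sf]; exists (fhom F s).
apply: eqh_trans (eqh_sym (fhom_comp _ _ _)) _.
exact: eqh_trans (fhom_eqh F sf) (fhom_id _ _).
Qed.

Lemma isomorphic_fobj (C D : category) (F : functor C D) (a b : C) :
  isomorphic a b -> isomorphic (F a) (F b).
Proof.
move=> [f [g [gf fg]]]; exists (fhom F f), (fhom F g); split.
  apply: eqh_trans (eqh_sym (fhom_comp _ _ _)) _.
  exact: eqh_trans (fhom_eqh F gf) (fhom_id _ _).
apply: eqh_trans (eqh_sym (fhom_comp _ _ _)) _.
exact: eqh_trans (fhom_eqh F fg) (fhom_id _ _).
Qed.

Lemma naturally_isomorphic_sym (C D : category) (F G : functor C D) :
  naturally_isomorphic F G -> naturally_isomorphic G F.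
Proof.
move=> [t [nt it]]; have st a := svalP (cid (it a)).
exists (fun a => sval (cid (it a))); split=> [a b f|a]; last first.
  by exists (t a); have [? ?] := st a.
apply: eqh_sym; apply: iso_square_inv (nt a b f).
  by have [] := st a.
by have [] := st b.
Qed.

(** By naturality, [t b] composed with f is determined by L f, and [t b] can be cancelled since it
    has a left inverse. No compatibility between the left inverses is needed. *)
Lemma split_unit_faithful (C D : category) (L : functor C D) (K : functor D C)
    (t : forall a, hom (@idf C a) (compf K L a)) :
  natural t -> (forall a, split_mono (t a)) -> faithful L.
Proof.
move=> nt split a b f g Lfg; have [s st] := split b.
have tfg : t b \oc f =h t b \oc g.
  apply: eqh_trans (nt _ _ f) _; apply: eqh_trans _ (eqh_sym (nt _ _ g)).
  by apply: comph_eqh (eqh_refl _); exact: (fhom_eqh K).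
have drop (u : hom a b) : u =h s \oc (t b \oc u).
  apply: eqh_sym; apply: eqh_trans (comphA _ _ _) _.
  exact: eqh_trans (comph_eqh st (eqh_refl _)) (comp1h _).
apply: eqh_trans (drop f) _; apply: eqh_trans _ (eqh_sym (drop g)).
exact: comph_eqh (eqh_refl _) tfg.
Qed.

(** * Natural transformations and functors on localizations *)

Section LocalizationTheory.
Variables (C : category) (W : forall a b : C, hom a b -> Prop).

Lemma loc_isomorphic (a b : C) (w : hom a b) :
  W w -> @isomorphic (localization W) a b.
Proof.
move=> Ww; exists (loc_fwd W w), (loc_inv Ww).
by split; [exact: loc_eq_invl|exact: loc_eq_invr].
Qed.

(** Morphisms of the localization are formal composites of morphisms of C and of inverses of W.
    Squares paste along composites, and the square of an inverse is that of [w] turned around. *)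
Lemma loc_natural (E : category) (F G : functor (localization W) E)
    (t : forall a : C, hom (F a) (G a)) :
  @natural C E (compf F (loc_functor W)) (compf G (loc_functor W)) t ->
  @natural (localization W) E F G t.
Proof.
move=> nt a b f; elim: f => {a b} [a b f|a b w Ww|a b c g IHg f IHf].
- exact: nt.
- have cancel (K : functor (localization W) E) :
      fhom K (loc_fwd W w : @hom (localization W) a b) \oc
        fhom K (loc_inv Ww : @hom (localization W) b a) =h idh (K b) /\
      fhom K (loc_inv Ww : @hom (localization W) b a) \oc
        fhom K (loc_fwd W w : @hom (localization W) a b) =h idh (K a).
    split; apply: eqh_trans (eqh_sym (fhom_comp _ _ _)) _;
      apply: eqh_trans (fhom_id _ _); apply: fhom_eqh.
      exact: loc_eq_invr.
    exact: loc_eq_invl.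
  apply: iso_square_inv (cancel F).1 (cancel G).2 _.
  by apply: eqh_sym; exact: nt.
apply: eqh_trans (comph_eqh (eqh_refl _) (fhom_comp _ _ _)) _.
apply: eqh_trans _ (eqh_sym (comph_eqh (fhom_comp _ _ _) (eqh_refl _))).
exact: square_paste IHf IHg.
Qed.

End LocalizationTheory.

Section LocalizedFunctor.
Variables (C D : category) (W : forall a b : C, hom a b -> Prop).
Variables (W' : forall a b : D, hom a b -> Prop) (F : functor C D).
Hypothesis FW : forall (a b : C) (w : hom a b), W w -> W' (fhom F w).

Fixpoint loc_map (a b : C) (f : loc_hom W a b) : loc_hom W' (F a) (F b) :=
  match f in loc_hom _ a b return loc_hom W' (F a) (F b) with
  | loc_fwd _ _ f => loc_fwd W' (fhom F f)
  | loc_inv _ _ w Ww => loc_inv (FW Ww)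
  | loc_comp _ _ _ g f => loc_comp (loc_map g) (loc_map f)
  end.

Lemma loc_map_eq (a b : C) (f g : loc_hom W a b) :
  loc_eq f g -> loc_eq (loc_map f) (loc_map g).
Proof.
have fwd_id c : loc_eq (loc_fwd W' (fhom F (idh c))) (loc_fwd W' (idh (F c))).
  exact/loc_eq_fwd/fhom_id.
elim=> {a b f g} /=.
- by move=> *; exact: loc_eq_refl.
- by move=> *; exact: loc_eq_sym.
- by move=> a b f g h _ fg _ gh; exact: loc_eq_trans fg gh.
- by move=> *; exact: loc_eq_comp.
- by move=> *; exact: loc_eq_compA.
- move=> a b f; apply: loc_eq_trans (loc_eq_comp1f _).
  exact: loc_eq_comp (fwd_id _) (loc_eq_refl _).
- move=> a b f; apply: loc_eq_trans (loc_eq_compf1 _).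
  exact: loc_eq_comp (loc_eq_refl _) (fwd_id _).
- by move=> *; exact/loc_eq_fwd/fhom_eqh.
- move=> a b c g f; apply: loc_eq_trans (loc_eq_fwd_comp _ _ _).
  exact/loc_eq_fwd/fhom_comp.
- move=> a b w Ww; apply: loc_eq_trans (loc_eq_invl (FW Ww)) _.
  exact/loc_eq_sym.
- move=> a b w Ww; apply: loc_eq_trans (loc_eq_invr (FW Ww)) _.
  exact/loc_eq_sym.
Qed.

Definition localized_functor : functor (localization W) (localization W') :=
  @Functor (localization W) (localization W') F loc_map loc_map_eq
    (fun a => loc_eq_fwd W' (fhom_id F a)) (fun _ _ _ _ _ => loc_eq_refl _).

End LocalizedFunctor.

(** * Free modules over an arbitrary ring and the dual basis of a projective module *)

Lemma linear_fun0 (R : pzRingType) (U V : lmodType R) (f : U -> V) :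
  linear f -> f 0 = 0.
Proof.
by move=> fl; apply: (addrI (f 0)); have := fl 1 0 0; rewrite !scale1r !addr0.
Qed.

Section FiniteSupport.
Variables (R : pzRingType) (K : choiceType).

Definition finite_support : {pred K -> R^o} :=
  fun f => `[< finite_set [set x | f x != 0] >].

Lemma finite_support_submod_closed : submod_closed finite_support.
Proof.
split.
  apply/asboolP; rewrite (_ : [set x | _] = set0); first exact: finite_set0.
  by rewrite predeqE => x /=; rewrite eqxx.
move=> c u v /asboolP uf /asboolP vf; apply/asboolP.
apply: (@sub_finite_set _ _ ([set x | u x != 0] `|` [set x | v x != 0])).
  move=> x /=; apply: contra_neqP => /not_orP[/negP + /negP].
  rewrite !negbK !fctE => /eqP -> /eqP ->.
  by rewrite scaler0 addr0.
by rewrite finite_setU.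
Qed.

HB.instance Definition _ := GRing.isSubmodClosed.Build R (K -> R^o)
  finite_support finite_support_submod_closed.

Record finsupp_module :=
  Finsupp { finsupp_fun :> K -> R^o; _ : finsupp_fun \in finite_support }.

HB.instance Definition _ := [isSub for finsupp_fun].
HB.instance Definition _ := [Choice of finsupp_module by <:].
HB.instance Definition _ := [SubChoice_isSubLmodule of finsupp_module by <:].

Lemma finsupp_linearE (c : R) (u v : finsupp_module) x :
  (c *: u + v) x = c * u x + v x.
Proof. by []. Qed.

Definition finsupp_seq (u : finsupp_module) : seq K :=
  fset_set [set x | u x != 0].

Lemma mem_finsupp_seq (u : finsupp_module) x : (x \in finsupp_seq u) = (u x != 0).
Proof.
case: u => u /= uf; rewrite /finsupp_seq in_fset_set; last exact/asboolP.
by apply/idP/idP => [/set_mem|ux] //; exact: mem_set.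
Qed.

Variables (M : lmodType R) (b : K -> M).

Definition finsupp_comb (u : finsupp_module) : M :=
  \sum_(x <- finsupp_seq u) (u x : R) *: b x.

(** Freedom in the choice of [s] lets several vectors be summed over one common list. *)
Lemma finsupp_combE (u : finsupp_module) (s : seq K) :
  uniq s -> {subset finsupp_seq u <= s} ->
  finsupp_comb u = \sum_(x <- s) (u x : R) *: b x.
Proof.
move=> us su; rewrite [RHS](bigID (mem (finsupp_seq u))) /=.
rewrite [X in _ + X]big1 => [|x]; last first.
  by rewrite mem_finsupp_seq negbK => /eqP ->; rewrite scale0r.
rewrite addr0 -big_filter; apply: perm_big; apply: uniq_perm.
- exact: fset_uniq.
- exact: filter_uniq.
by move=> x; rewrite mem_filter; case: (boolP (_ \in _)) => [/su|].
Qed.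

Lemma finsupp_comb_linear : linear finsupp_comb.
Proof.
move=> c u v; pose s := undup (finsupp_seq u ++ finsupp_seq v).
have us : uniq s by exact: undup_uniq.
rewrite !(finsupp_combE us).
- rewrite scaler_sumr -big_split; apply: eq_bigr => x _ /=.
  by rewrite scalerA -scalerDl.
- by move=> x xv; rewrite mem_undup mem_cat xv orbT.
- by move=> x xu; rewrite mem_undup mem_cat xu.
move=> x; rewrite mem_undup mem_cat !mem_finsupp_seq finsupp_linearE.
apply: contra_neqT; rewrite negb_or !negbK => /andP[/eqP -> /eqP ->].
by rewrite mulr0 addr0.
Qed.

HB.instance Definition _ := GRing.isLinear.Build R finsupp_module M _
  finsupp_comb finsupp_comb_linear.

Lemma finsupp_delta_subproof (x : K) :
  ((fun y => (y == x)%:R) : K -> R^o) \in finite_support.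
Proof.
apply/asboolP; apply: (@sub_finite_set _ _ [set x]); last exact: finite_set1.
by move=> y /=; case: (eqVneq y x) => // _; rewrite eqxx.
Qed.

Definition finsupp_delta (x : K) : finsupp_module :=
  Finsupp (finsupp_delta_subproof x).

Lemma finsupp_comb_delta (x : K) : finsupp_comb (finsupp_delta x) = b x.
Proof.
rewrite (@finsupp_combE _ [:: x]) ?big_seq1 //= ?eqxx ?scale1r // => y.
by rewrite mem_finsupp_seq inE /=; case: (eqVneq y x) => //; rewrite eqxx.
Qed.

End FiniteSupport.

Section ProjectiveModules.
Variable R : pzRingType.

Definition finsupp_coord (K : choiceType) (x : K) (u : finsupp_module R K) : R^o :=
  u x.

Lemma finsupp_coord_linear (K : choiceType) (x : K) : linear (@finsupp_coord K x).
Proof. by []. Qed.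

HB.instance Definition _ (K : choiceType) (x : K) :=
  GRing.isLinear.Build R (finsupp_module R K) R^o _ (finsupp_coord x)
    (finsupp_coord_linear x).

(** The generating family is P itself: a section of the canonical surjection from the free module on
    P has the [e y] as its coordinates. Allowing every larger list s' lets finitely many elements be
    expanded over the same list. *)
Lemma dual_basis (P : lmodType R) : projective P ->
  exists e : P -> {linear P -> R^o}, forall x, exists s : seq P,
    forall s', uniq s' -> {subset s <= s'} -> x = \sum_(y <- s') (e y x : R) *: y.
Proof.
move=> projP.
have [|h hK] := projP (finsupp_module R P) P (finsupp_comb (@id P)) idfun.
  by move=> x; exists (finsupp_delta R x); exact: finsupp_comb_delta.
exists (fun y => finsupp_coord y \o h) => x; exists (finsupp_seq (h x)) => s us hs.
exact: etrans (esym (hK x)) (finsupp_combE id us hs).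
Qed.

End ProjectiveModules.

(** * The unit of the adjunction, and its bijectivity on projective modules *)

Section Unit.
Variables (k : fieldType) (G : topologicalGroupType) (p : nat).
Variable I : open_prop_subgroup p G.
Local Notation X := (ind_smooth_rep k I).
Local Notation H := (hecke k I).
Local Notation char := (ind_char k I : X).

(** The translates of [char] span X. With [hecke_of_fixed], this identifies H with X^I. *)
Lemma hecke_ext (a b : H) : hecke_fun a char = hecke_fun b char -> a = b.
Proof.
move=> ab; apply: endo_ext; apply: ind_hom_ext.
- exact: endo_linear.
- exact: endo_linear.
by move=> g; rewrite !endo_act; congr (act g _).
Qed.

Lemma hecke_of_fixed (x : X) :
  x \in @is_fixed _ _ _ I X -> exists a : H, hecke_fun a char = x.
Proof.
move=> xI.
have ef : (@frob k G p I X x : X -> X) \in @is_rep_endo k G X.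
  by apply/asboolP; split=> [|g f]; [exact: frob_linear|exact: frob_act].
by exists (RepEndo ef); exact: frob1.
Qed.

Section UnitMap.
Variable M : lmodType H.

Lemma unit_subproof (m : M) :
  (pure char m : tensor_rep M) \in @is_fixed _ _ _ I (tensor_rep M).
Proof.
apply/asboolP => i Ii; rewrite /= tensor_act_pure; congr (pure _ m).
exact: ind_act_char.
Qed.

Definition unit_fun (m : M) : fixed I (tensor_rep M) := Fixed (unit_subproof m).

(** Both sides are G-equivariant in x and agree at [char]. This makes the unit H-linear, as the
    action on fixed vectors is defined through [frob]. *)
Lemma frob_unit m (x : X) : frob (unit_fun m : tensor_rep M) x = pure x m.
Proof.
move: x; apply/fsym/frob_uniq => [|c x y|g x|//].
- exact: fixedP.
- by rewrite pureDl pureZ.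
by rewrite /= tensor_act_pure.
Qed.

Lemma unit_linear : linear unit_fun.
Proof.
move=> a m n; apply: fixed_ext; rewrite /= frob_unit pureDr.
by rewrite pure_balance.
Qed.

HB.instance Definition _ := GRing.isLinear.Build H M (fixed I (tensor_rep M)) _
  unit_fun unit_linear.

Section Coordinate.
Variable e : {linear M -> H^o}.

Lemma tensor_coord_balanced :
  balanced (fun (x : X) (m : M) => hecke_fun (e m) x : X).
Proof.
split=> [x y m|x m n|c x m|x h m].
- exact: endoD.
- by rewrite linearD.
- have := endo_linear (hecke_fun (e m)) c x 0.
  by rewrite (linear_fun0 (endo_linear _)) !addr0.
by rewrite linearZ -hecke_funM.
Qed.

(** This is F applied to the functional [e], followed by the identification of X (x)_H H with X. *)
Definition tensor_coord : tensor M -> X :=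
  tensor_lift (fun x m => hecke_fun (e m) x).

Lemma tensor_coord_linear : linear tensor_coord.
Proof. exact/tensor_lift_linear/tensor_coord_balanced. Qed.

Lemma tensor_coord_pure x m : tensor_coord (pure x m) = hecke_fun (e m) x.
Proof. exact/tensor_lift_pure/tensor_coord_balanced. Qed.

Lemma tensor_coord_act g t : tensor_coord (tensor_act g t) = act g (tensor_coord t).
Proof.
move: t; apply: tensor_ext => [c s t|c s t|x m].
- by rewrite tensor_act_linear tensor_coord_linear.
- by rewrite tensor_coord_linear act_linear.
by rewrite tensor_act_pure !tensor_coord_pure endo_act.
Qed.

End Coordinate.

Definition unit_map : @hom (Mod H) M (functor_U k I (functor_F k I M)) :=
  (unit_fun : {linear M -> fixed I (tensor_rep M)}).

End UnitMap.

Lemma unit_natural (M N : lmodType H) (f : {linear M -> N}) m :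
  unit_fun (f m) = fixed_map (tensor_map f) (unit_fun m).
Proof. by apply: fixed_ext; rewrite /= tensor_fun_pure. Qed.

Section ProjectiveUnit.
Variables (P : lmodType H) (projP : projective P).

(** If 1_I (x) x = 0, applying [tensor_coord] shows that every coordinate of x kills [char], so it
    vanishes by [hecke_ext]. *)
Lemma unit_injective : injective (@unit_fun P).
Proof.
have [e eP] := dual_basis projP.
suff inj0 (x : P) : unit_fun x = 0 -> x = 0.
  by move=> x y xy; apply: subr0_eq; apply: inj0; rewrite linearB /= xy subrr.
move=> ux0; have [s sP] := eP x.
rewrite (sP (undup s)) ?undup_uniq // => [|y]; last by rewrite mem_undup.
apply: big1 => y _; suff -> : e y x = 0 by rewrite scale0r.
apply: hecke_ext; rewrite -tensor_coord_pure.
have -> : pure char x = 0 by exact: (congr1 (@fixed_val _ _ _ _ _) ux0).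
exact: linear_fun0 (tensor_coord_linear _).
Qed.

(** A tensor t expands as the sum of its coordinates in X tensored with the generators. If t is
    I-fixed, so are its coordinates; each is then h_y(1_I) for some h_y in H, and h_y moves across
    the tensor sign, leaving 1_I (x) sum h_y y. *)
Lemma unit_surjective : surjective (@unit_fun P).
Proof.
have [e eP] := dual_basis projP.
(* The dual basis expansion carried over to X (x)_H P, with coefficients in X in place of H. *)
have decomp (t : tensor P) : exists s : seq P, forall s', uniq s' ->
    {subset s <= s'} -> t = \sum_(y <- s') pure (tensor_coord (e y) t) y.
  move: t; apply: tensor_ind => [|c x m t [s1 s1P]].
    exists [::] => s _ _; rewrite big1 // => y _.
    have pure0 : pure (0 : X) y = 0 by have := pureZ 0 (0 : X) y; rewrite !scale0r.
    by rewrite (linear_fun0 (tensor_coord_linear _)).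
  have [s2 s2P] := eP m; exists (s1 ++ s2) => s us ss.
  have ss1 : {subset s1 <= s} by move=> y ys; apply: ss; rewrite mem_cat ys.
  have ss2 : {subset s2 <= s} by move=> y ys; apply: ss; rewrite mem_cat ys orbT.
  rewrite {1}(s1P s us ss1) {1}(s2P s us ss2).
  have -> : pure x (\sum_(y <- s) (e y m : H) *: y) =
      \sum_(y <- s) pure (hecke_fun (e y m) x) y.
    elim: (s) => [|y r IH]; last by rewrite !big_cons pureDr IH pure_balance.
    by rewrite !big_nil; apply: (addrI (pure x 0)); rewrite -pureDr !addr0.
  rewrite scaler_sumr -big_split; apply: eq_bigr => y _ /=.
  by rewrite tensor_coord_linear tensor_coord_pure pureDl pureZ.
move=> w; have [s /(_ (undup s) (undup_uniq s))] := decomp (fixed_val w).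
move=> wE; have {}wE := wE (fun y ys => etrans (mem_undup s y) ys).
have fixed_coord y : tensor_coord (e y) (fixed_val w) \in @is_fixed _ _ _ I X.
  apply/asboolP => i Ii; rewrite -tensor_coord_act; congr (tensor_coord _ _).
  by have /asboolP := fixedP w; exact.
have [h hP] := choice (fun y => hecke_of_fixed (fixed_coord y)).
exists (\sum_(y <- undup s) h y *: y); apply: fixed_ext; rewrite {}wE /=.
elim: (undup s) => [|y r IH].
  by rewrite !big_nil; apply: (addrI (pure char 0)); rewrite -pureDr !addr0.
by rewrite !big_cons pureDr -pure_balance hP IH.
Qed.

End ProjectiveUnit.

(** * Kernels of maps between projectives: the retraction of the unit and the kernel
    representation *)

Section Copresented.
Variables (M P0 P1 : lmodType H) (j : {linear M -> P0}) (d : {linear P0 -> P1}).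
Hypotheses (projP0 : projective P0) (projP1 : projective P1).
Hypotheses (inj_j : injective j) (exact_jd : exact j d).

(** Surjectivity of the unit at P0 lifts [w] to P0; injectivity at P1 shows that [d] kills the
    lift. *)
Lemma unit_kernel (w : fixed I (tensor_rep P0)) :
  fixed_map (tensor_map d) w = 0 <-> exists m, unit_fun (j m) = w.
Proof.
split=> [dw|[m <-]]; last first.
  rewrite -unit_natural; have -> : d (j m) = 0 by apply/exact_jd; exists m.
  exact: linear0.
have [y yw] := unit_surjective projP0 w.
have [|m jm] := (exact_jd y).1; last by exists m; rewrite jm.
by apply: (unit_injective projP1); rewrite unit_natural yw dw linear0.
Qed.

(** Since F[d] F[j] = 0, the image of UFM in UFP0 lies in ker(UF[d]), which is M by [unit_kernel].
    Naturality of the unit makes this map a retraction. *)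
Lemma unit_retraction :
  exists r : {linear fixed I (tensor_rep M) -> M}, forall m, r (unit_fun m) = m.
Proof.
have ex (w : fixed I (tensor_rep M)) :
    exists m, unit_fun (j m) = fixed_map (tensor_map j) w.
  apply/unit_kernel; apply: fixed_ext => /=.
  have dj0 : tensor_fun d \o tensor_fun j =1 (fun=> 0).
    apply: tensor_ext => [c s t|c s t|x m] /=; first by rewrite !linearP.
      by rewrite scaler0 addr0.
    rewrite !tensor_fun_pure; have -> : d (j m) = 0 by apply/exact_jd; exists m.
    by apply: (addrI (pure x 0)); rewrite -pureDr !addr0.
  exact: dj0.
have [r rP] := choice ex.
have inj m n : unit_fun (j m) = unit_fun (j n) -> m = n.
  by move=> /(unit_injective projP0)/inj_j.
(* [r] is a mere choice function; linearity holds because it can be tested after the injection M ->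
   P0 -> UFP0. *)
have rl : linear r.
  by move=> a u v; apply: inj; rewrite rP !linearP /= !rP.
pose rL := GRing.isLinear.Build H (fixed I (tensor_rep M)) M _ r rl.
exists (HB.pack r rL : {linear _ -> _}) => m /=.
by apply: inj; rewrite rP -unit_natural.
Qed.

Definition ker_tensor : {pred tensor P0} := fun t => tensor_fun d t == 0.

Lemma ker_tensor_submod_closed : submod_closed ker_tensor.
Proof.
split=> [|c s t /eqP ds /eqP dt]; apply/eqP; first exact: linear0.
by rewrite tensor_fun_linear ds dt scaler0 addr0.
Qed.

HB.instance Definition _ := GRing.isSubmodClosed.Build k (tensor P0)
  ker_tensor ker_tensor_submod_closed.

Record kernel := Kernel { kernel_val :> tensor P0; _ : kernel_val \in ker_tensor }.

HB.instance Definition _ := [isSub for kernel_val].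
HB.instance Definition _ := [Choice of kernel by <:].
HB.instance Definition _ := [SubChoice_isSubLmodule of kernel by <:].

Lemma kernel_act_subproof g (t : kernel) :
  tensor_act g (kernel_val t) \in ker_tensor.
Proof.
case: t => t /= /eqP dt; apply/eqP.
have := tensor_fun_act d g (t : tensor_rep P0).
by rewrite dt act0.
Qed.

Definition kernel_act g (t : kernel) : kernel := Kernel (kernel_act_subproof g t).

Lemma kernel_act_linear g : linear (kernel_act g).
Proof. by move=> c s t; apply: val_inj; exact: tensor_act_linear. Qed.

Lemma kernel_act1 t : kernel_act 1%g t = t.
Proof. by apply: val_inj; exact: tensor_act1. Qed.

Lemma kernel_actM g h t : kernel_act (g * h)%g t = kernel_act g (kernel_act h t).
Proof. by apply: val_inj; exact: tensor_actM. Qed.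

Lemma kernel_smooth t : open [set g | kernel_act g t = t].
Proof.
rewrite (_ : [set g | _] = [set g | tensor_act g (kernel_val t) = kernel_val t]).
  exact: tensor_smooth.
rewrite predeqE => g; split=> gt; last exact: val_inj.
exact: (congr1 kernel_val (gt : kernel_act g t = t)).
Qed.

Definition kernel_rep : smooth_rep k G :=
  @SmoothRep k G kernel kernel_act kernel_act_linear kernel_act1 kernel_actM
    kernel_smooth.

Lemma kernel_val_linear : linear kernel_val.
Proof. by []. Qed.

HB.instance Definition _ := GRing.isLinear.Build k kernel (tensor P0) _
  kernel_val kernel_val_linear.

Definition kernel_incl : rep_hom kernel_rep (tensor_rep P0) :=
  @RepHom k G kernel_rep (tensor_rep P0) kernel_val (fun _ _ => erefl).

(** Taking I-fixed vectors is left exact: those of ker(F[d]) are the elements of UFP0 killed by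
    UF[d], that is, M by [unit_kernel]. *)
Lemma fixed_kernel_isomorphic :
  @isomorphic (Mod H) (fixed I kernel_rep) M.
Proof.
have incl_inj : injective (@fixed_map _ _ _ I _ _ kernel_incl).
  move=> u v uv; apply/fixed_ext/val_inj.
  exact: (congr1 (@fixed_val _ _ _ _ _) uv).
have ex (w : fixed I kernel_rep) :
    exists m, unit_fun (j m) = fixed_map kernel_incl w.
  by apply/unit_kernel/fixed_ext => /=; case: (fixed_val w) => t /= /eqP.
have [r rP] := choice ex.
have inj m n : unit_fun (j m) = unit_fun (j n) -> m = n.
  by move=> /(unit_injective projP0)/inj_j.
have ex' (m : M) : exists w, fixed_map kernel_incl w = unit_fun (j m).
  have km : (pure char (j m) : tensor P0) \in ker_tensor.
    have d0 := (unit_kernel _).2 (ex_intro _ m erefl).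
    by apply/eqP; exact: (congr1 (@fixed_val _ _ _ _ _) d0).
  have fm : (Kernel km : kernel_rep) \in @is_fixed _ _ _ I kernel_rep.
    apply/asboolP => i Ii; apply: val_inj => /=.
    by have /asboolP/(_ i Ii) := unit_subproof (j m).
  by exists (Fixed fm); apply: fixed_ext.
have [s sP] := choice ex'.
have rl : linear r.
  by move=> a u v; apply: inj; rewrite rP !linearP /= !rP.
have sl : linear s.
  by move=> a u v; apply: incl_inj; rewrite sP !linearP /= !sP.
pose rL := GRing.isLinear.Build H (fixed I kernel_rep) M _ r rl.
pose sL := GRing.isLinear.Build H M (fixed I kernel_rep) _ s sl.
exists (HB.pack r rL : {linear _ -> _}), (HB.pack s sL : {linear _ -> _}).
split=> [w|m] /=; first by apply: incl_inj; rewrite sP rP.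
by apply: inj; rewrite rP sP.
Qed.

End Copresented.

(** The cokernel of the cofibration 0 -> M is M up to isomorphism, so M inherits the start of the
    complex of projectives attached to that cokernel. *)
Lemma cofibrant_copresentation (M : Mod H) : cofibrant (GP_model H) M ->
  exists (P0 P1 : lmodType H) (j : {linear M -> P0}) (d : {linear P0 -> P1}),
    [/\ projective P0, projective P1, injective j & exact j d].
Proof.
move=> cofM; pose Z : Mod H := 'rV[H]_0.
have iZ : initial Z.
  move=> N; exists (\0 : {linear 'rV[H]_0 -> N}) => g x.
  by rewrite (_ : x = 0) ?linear0 //; apply/rowP => -[].
have [_ [C [q [sq eq [Y [d [projY exY _ [j [injj exj]]]]]]]]] :=
  cofM Z (\0 : {linear 'rV[H]_0 -> M}) iZ.
(* [q] is the cokernel of the zero map, so its kernel is zero. *)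
have injq : injective q.
  move=> x y xy; apply: subr0_eq; have [|z <- //] := (eq (x - y)).1.
  by rewrite linearB xy subrr.
exists (Y (-1 + 1)), (Y (-1)), (j \o q), (d (-1)); split=> //.
  exact: inj_comp.
move=> y; split=> [dy|[x <-]]; last by apply/exj; exists (q x).
have [c <-] := (exj y).1 dy; have [m <-] := sq c.
by exists m.
Qed.

End Unit.

(** * Assembly in the homotopy categories *)

Theorem theorem4p22 (k : fieldType) (p : nat) (char_k : p \in [pchar k]%R)
    (G : topologicalGroupType) (I : open_prop_subgroup p G)
    (gorenstein_H : Gorenstein_ring (hecke k I))
    (LF : functor (Ho (GP_model (hecke k I))) (Ho (I_GP_model k I)))
    (RU : functor (Ho (I_GP_model k I)) (Ho (GP_model (hecke k I))))
    (derived_LF : total_left_derived (functor_F k I) LF)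
    (derived_RU : total_right_derived (functor_U k I) RU) :
  faithful LF /\ essentially_surjective RU.
Proof.
have [Q [q [[nq qP] isoLF]]] := derived_LF.
have [R [r [[_ rP] [u [_ isou]]]]] := derived_RU.
pose MC := GP_model (hecke k I); pose MD := I_GP_model k I.
have copres M := cofibrant_copresentation (qP M).1.
split.
  (* In the right transfer, [f] is a weak equivalence exactly when U[f] is, so the identity proves
     that U preserves them. *)
  pose U' : functor (Ho MD) (Ho MC) := @localized_functor _ _
    (@weak_equivalence _ MD) (@weak_equivalence _ MC) (functor_U k I)
    (fun _ _ _ Ww => Ww).
  have [t [nt it]] := naturally_isomorphic_sym isoLF.
  pose q' M : @hom (Ho MC) M (Q M) := loc_inv (qP M).2.2.
  pose eta M : @hom (Ho MC) (Q M) _ := fhom (gamma MC) (unit_map (Q M)).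
  (* The derived unit M -> QM -> UFQM -> U' LF M: the inverse of the replacement map, the unit at
     QM, and the identification of FQM with LF M. *)
  pose T M : @hom (Ho MC) M (U' (LF M)) := fhom U' (t M) \oc (eta M \oc q' M).
  apply: (@split_unit_faithful _ _ LF U' T).
    (* Only morphisms of Mod(H) need checking; the square is pasted from one square for each factor
       of T. *)
    apply: loc_natural => M N f; apply: eqh_sym.
    have qf : fhom (gamma MC) (fhom Q f) \oc q' M =h q' N \oc fhom (gamma MC) f.
      apply: (@iso_square_inv (Ho MC) _ _ _ _ _ _ (fhom (gamma MC) (q M)) _
        (fhom (gamma MC) (q N)) _ (loc_eq_invr _) (loc_eq_invl _)).
      apply: eqh_trans (eqh_sym (fhom_comp _ _ _)) _.
      apply: eqh_trans _ (fhom_comp _ _ _).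
      by apply: fhom_eqh; exact: nq.
    have etaf : fhom (gamma MC) (fhom (functor_U k I) (fhom (functor_F k I)
        (fhom Q f))) \oc eta M =h eta N \oc fhom (gamma MC) (fhom Q f).
      apply: eqh_trans (eqh_sym (fhom_comp (gamma MC) _ (unit_map (Q M)))) _.
      apply: eqh_trans _ (fhom_comp (gamma MC) (unit_map (Q N)) _).
      by apply: fhom_eqh => m; rewrite /= -unit_natural.
    have tf : fhom U' (fhom LF (fhom (gamma MC) f)) \oc fhom U' (t M) =h
        fhom U' (t N) \oc fhom (gamma MC) (fhom (functor_U k I)
        (fhom (functor_F k I) (fhom Q f))).
      apply: eqh_trans (eqh_sym (fhom_comp U' _ _)) _.
      apply: eqh_trans _ (fhom_comp U' (t N) (fhom (gamma MD) _)).
      by apply: fhom_eqh; apply: eqh_sym; exact: nt.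
    exact: square_paste (square_paste qf etaf) tf.
  (* The outer factors are isomorphisms, and the unit at the cofibrant QM already has a retraction
     in Mod(H). *)
  move=> M; apply: split_mono_comp; first apply: split_mono_comp.
  - by exists (fhom (gamma MC) (q M)); exact: loc_eq_invr.
  - have [P0 [P1 [j [d [projP0 projP1 injj exj]]]]] := copres M.
    apply: (split_mono_fhom (gamma MC)).
    have [s sE] := unit_retraction projP0 projP1 injj exj.
    by exists s.
  by apply: (split_mono_fhom U'); have [s [st _]] := it M; exists s.
move=> M; have [P0 [P1 [j [d [projP0 projP1 injj exj]]]]] := copres M.
(* With V = ker(F[d]), the chain in Ho(Mod(H)) is: RU V is URV as derived functor, URV is UV since U
   sends [r] to a weak equivalence, UV is QM by left exactness, and QM is M through [q]. *)
exists (kernel_rep d).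
apply: isomorphic_trans (ex_intro _ _ (isou _)) _.
apply: (@isomorphic_trans (Ho MC) _ (functor_U k I (kernel_rep d))).
  apply: isomorphic_sym; exact: (@loc_isomorphic _ (@weak_equivalence _ MC)
    _ _ (fhom (functor_U k I) (r (kernel_rep d))) (rP (kernel_rep d)).2.2).
apply: (@isomorphic_trans (Ho MC) _ (Q M)).
  apply: (isomorphic_fobj (gamma MC)).
  exact: fixed_kernel_isomorphic exj.
exact: (loc_isomorphic (qP M).2.2).
Qed.
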